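(* Let $B>0$ and let $\phi\in L^2(\mathbb{R})$ be a real-valued window such that $(\mathcal{F}\phi)(\xi)\neq 0$ for almost every $\xi\in(-B,B)$. Then for all $f,g\in\mathrm{PW}^2_B$ that are real-valued on the real line, the following are equivalent: (1) $f=\pm g$; (2) $\left|\mathcal{V}_\phi f\left(\tfrac{n}{4B},0\right)\right|=\left|\mathcal{V}_\phi g\left(\tfrac{n}{4B},0\right)\right|$ for all $n\in\mathbb{Z}$.
   Context: The Fourier transform is $\mathcal{F}f(\xi)=\int_{\mathbb{R}}f(t)e^{-2\pi i t\xi}\,dt$ on $L^1(\mathbb{R})$, extended to $L^2(\mathbb{R})$ by density. For $B>0$, the Paley--Wiener space is $\mathrm{PW}^2_B:=\{f:\mathbb{C}\to\mathbb{C} \mid \exists F\in L^2([-B,B])\ \forall z\in\mathbb{C}: f(z)=\int_{-B}^B F(\xi)e^{2\pi i \xi z}\,d\xi\}$; its elements are identified with their restrictions to $\mathbb{R}$ (which lie in $L^2(\mathbb{R})$) when transforms are applied. For $f,\phi\in L^2(\mathbb{R})$ the short-time Fourier transform is $\mathcal{V}_\phi f(x,\omega)=\int_{\mathbb{R}} f(t)\overline{\phi(t-x)}e^{-2\pi i t\omega}\,dt$, $x,\omega\in\mathbb{R}$. *)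

(* Defs.v *)
From HB Require Import structures.
From mathcomp Require Import all_boot all_order all_algebra.
From mathcomp Require Import all_classical all_reals all_analysis.
From mathcomp Require Export complex.

Set Implicit Arguments.
Unset Strict Implicit.
Unset Printing Implicit Defensive.

Import Order.TTheory GRing.Theory Num.Theory.
Local Open Scope classical_set_scope.
Local Open Scope ring_scope.

Section Defs.
Variable R : realType.
Local Notation mu := (@lebesgue_measure R).
Local Notation C := (R[i]).

Definition expi (t : R) : C := Complex (cos t) (sin t).

Definition cexp (z : C) : C := (Complex (expR (complex.Re z)) 0) * expi (complex.Im z).

Definition cabs (z : C) : R := Num.sqrt (complex.Re z ^+ 2 + complex.Im z ^+ 2).

Definition cintegral (D : set R) (h : R -> C) : C :=
  Complex (\int[mu]_(t in D) complex.Re (h t))%R (\int[mu]_(t in D) complex.Im (h t))%R.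

Definition cmeasurable (D : set R) (h : R -> C) : Prop :=
  measurable_fun D (fun t => complex.Re (h t)) /\ measurable_fun D (fun t => complex.Im (h t)).

Definition cL1 (D : set R) (h : R -> C) : Prop :=
  cmeasurable D h /\ (\int[mu]_(t in D) (cabs (h t))%:E < +oo)%E.

Definition cL2 (D : set R) (h : R -> C) : Prop :=
  cmeasurable D h /\ (\int[mu]_(t in D) ((cabs (h t)) ^+ 2)%:E < +oo)%E.

Definition cL2dist2 (h k : R -> C) : \bar R :=
  (\int[mu]_t ((cabs (h t - k t)) ^+ 2)%:E)%E.

Definition fourierL1 (u : R -> C) (xi : R) : C :=
  cintegral setT (fun t => u t * expi (- (2 * pi * t * xi))).

(** Fourier transform on L^2(R), extended from L^1 ∩ L^2 by density:
    Phi is the L^2 Fourier transform of u iff Phi ∈ L^2 and for every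
    sequence v_n in L^1 ∩ L^2 converging to u in L^2, F v_n converges to Phi
    in L^2. *)
Definition is_fourierL2 (u Phi : R -> C) : Prop :=
  cL2 setT Phi /\
  forall v : nat -> R -> C,
    (forall n, cL1 setT (v n) /\ cL2 setT (v n)) ->
    cL2dist2 (v n) u @[n --> \oo] --> 0%E ->
    cL2dist2 (fourierL1 (v n)) Phi @[n --> \oo] --> 0%E.

Definition PW (B : R) (f : C -> C) : Prop :=
  exists F : R -> C, cL2 `[- B, B] F /\
    forall z : C,
      f z = cintegral `[- B, B]
              (fun xi => F xi * cexp (Complex 0 (2 * pi * xi) * z)).

Definition restrR (f : C -> C) : R -> C := fun t => f (Complex t 0).

Definition stft (phi u : R -> C) (x omega : R) : C :=
  cintegral setT (fun t => u t * conjc (phi (t - x)) * expi (- (2 * pi * t * omega))).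

End Defs.

(* Main.v *)
(** Write [Phi] for the Fourier transform of [phi], and [F], [G] for the spectra of [f], [g]. By
    Parseval, [V_phi f(x, 0)] is the inverse Fourier transform of [F * conj Phi], an [L^1] function
    supported in [[-B, B]], and it is real.  Put [p = V_phi f - V_phi g], [q = V_phi f + V_phi g],
    with spectra [P], [Q].  Then (2) says that [p q], the transform of the function
    [P (xi) * Q (eta)] along [xi + eta] in [[-2B, 2B]], vanishes at the points [n / (4 B)].

    Uniqueness of Fourier coefficients makes [p q] vanish on the whole line: the functions [W] with
    [int W exp(i n theta) = 0] for all [n] are stable under multiplication by [sin (theta - a)],
    hence under multiplication by polynomials in it and by its sign, so that [W] is orthogonal to
    all indicators of arcs.  By continuity [p] or [q] vanishes near some point, and there the
    functions whose transform vanishes on an interval are stable under multiplication by the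
    variable, hence by indicators of half lines: [P = 0] or [Q = 0] almost everywhere.  Since [Phi]
    does not vanish on the band, [F = G] or [F = - G] almost everywhere.

    That [f] is square integrable on the line, which Parseval requires, comes from Bessel's
    inequality for the samples [f (s + n / (2 B))], integrated in [s]. *)

Require Import Defs.
From HB Require Import structures.
From mathcomp Require Import all_boot all_order all_algebra.
From mathcomp Require Import all_classical all_reals all_analysis.
From mathcomp Require Import complex ring lra measurable_realfun measurable_fun_approximation.

Set Implicit Arguments.
Unset Strict Implicit.
Unset Printing Implicit Defensive.

Import Order.TTheory GRing.Theory Num.Theory.
Import numFieldNormedType.Exports.
Local Open Scope classical_set_scope.
Local Open Scope ring_scope.

(** * Integrable real-valued functions *)

Notation rint mu f := (mu.-integrable [set: _] (EFin \o f)).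

Section RealIntegrable.
Context d (T : measurableType d) (R : realType)
  (mu : {measure set T -> \bar R}).
Implicit Types (f g u m : T -> R).

Local Notation rint f := (rint mu f).

Lemma rint_measurable f : rint f -> measurable_fun setT f.
Proof. by move=> /(measurable_int mu)/measurable_EFinP. Qed.

Lemma rintD f g : rint f -> rint g -> rint (fun x => f x + g x).
Proof.
move=> fi gi; have := integrableD measurableT fi gi.
by apply: eq_integrable.
Qed.

Lemma rintZ a f : rint f -> rint (fun x => a * f x).
Proof. by move=> fi; have := integrableZl measurableT a fi; apply: eq_integrable. Qed.

Lemma rintN f : rint f -> rint (fun x => - f x).
Proof. by move=> /(rintZ (-1)); apply: eq_integrable => // x _ /=; rewrite mulN1r. Qed.

Lemma rintB f g : rint f -> rint g -> rint (fun x => f x - g x).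
Proof. by move=> fi /rintN; exact: rintD. Qed.

Lemma rint_dom g f : measurable_fun setT f -> (forall x, `|f x| <= g x) ->
  rint g -> rint f.
Proof.
move=> mf fg; apply: le_integrable => //; first exact/measurable_EFinP.
by move=> x _ /=; rewrite lee_fin (le_trans (fg x))// ler_norm.
Qed.

Lemma rint_bmul M m u : measurable_fun setT m -> (forall x, `|m x| <= M) ->
  rint u -> rint (fun x => u x * m x).
Proof.
move=> mm mM ui; apply: (@rint_dom (fun x => M * `|u x|)).
- by apply: measurable_funM => //; exact: rint_measurable.
- by move=> x; rewrite normrM mulrC ler_wpM2r.
- exact/rintZ/integrable_norm.
Qed.

Lemma rint_sum (I : Type) (s : seq I) (F : I -> T -> R) :
  (forall i, rint (F i)) -> rint (fun x => \sum_(i <- s) F i x).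
Proof.
move=> Fi; have := @integrable_sum _ _ _ mu _ measurableT _ s xpredT (fun i => EFin \o F i) (fun i _ => Fi i).
by apply: eq_integrable => // x _ /=; rewrite sumEFin.
Qed.

Lemma Rint_sum (I : Type) (s : seq I) (F : I -> T -> R) :
  (forall i, rint (F i)) ->
  (\int[mu]_x \sum_(i <- s) F i x) = \sum_(i <- s) (\int[mu]_x F i x).
Proof.
move=> Fi; elim: s => [|i s ih].
  under eq_Rintegral do rewrite big_nil.
  by rewrite big_nil Rintegral_cst// mul0r.
under eq_Rintegral do rewrite big_cons.
by rewrite big_cons RintegralD// ?ih//; exact: rint_sum.
Qed.

Lemma rint_EFin f : rint f -> (\int[mu]_x (f x)%:E)%E = (\int[mu]_x f x)%:E.
Proof. by move=> fi; rewrite /Rintegral fineK//; exact: integrable_fin_num. Qed.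

(** Pointwise convergence everywhere makes the limit measurable and passes the bound [g] on to it,
    so integrability of the limit comes together with convergence of the real integrals. *)
Lemma Rint_dominated (f_ : nat -> T -> R) f g :
  (forall n, measurable_fun setT (f_ n)) -> rint g ->
  (forall n x, `|f_ n x| <= g x) ->
  (forall x, f_ n x @[n --> \oo] --> f x) ->
  rint f /\ (\int[mu]_x f_ n x) @[n --> \oo] --> (\int[mu]_x f x).
Proof.
move=> mf gi fg ff.
have mff : measurable_fun setT f.
  exact: (measurable_fun_cvg mf (fun x _ => ff x)).
have fi : rint f.
  apply: (rint_dom mff _ gi) => x.
  have : `|f_ n x| @[n --> \oo] --> `|f x| by apply: cvg_norm; exact: ff.
  by move=> h; apply: (cvgr_to_le h); apply: nearW => n; exact: fg.
have fni n : rint (f_ n) by apply: rint_dom gi.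
split=> //.
suff : (\int[mu]_x (f_ n x)%:E)%E @[n --> \oo] --> (\int[mu]_x f x)%:E.
  by move/fine_cvgP => [].
have [|||||_ _] := @dominated_convergence _ _ _ mu setT measurableT
  (fun n => EFin \o f_ n) (EFin \o f) (EFin \o g).
- by move=> n; exact/measurable_EFinP.
- exact/measurable_EFinP.
- by apply: aeW => x _; apply: cvg_EFin; [exact: nearW|exact: ff].
- exact: gi.
- by apply: aeW => x n _ /=; rewrite lee_fin fg.
by rewrite -rint_EFin.
Qed.

Lemma eq_rint f g : f =1 g -> rint f -> rint g.
Proof. by move=> fg; apply: eq_integrable => // x _ /=; rewrite fg. Qed.

Lemma Rint0 : (\int[mu]_x (0 : R)) = 0.
Proof. by rewrite Rintegral_cst// mul0r. Qed.

End RealIntegrable.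

(** * Multiplication by indicators through polynomials *)

(** Carries integrals that vanish along an approximating sequence over to the limit. *)
Lemma cvg_eq_cst (R : realType) (u : nat -> R) (c l : R) :
  (\forall n \near \oo, u n = c) -> u n @[n --> \oo] --> l -> l = c.
Proof.
move=> uc ul; have uc' : u n @[n --> \oo] --> c by exact: cvg_near_cst.
exact: (cvg_unique _ ul uc').
Qed.

Section SignPolynomial.
Variable R : realType.

(* The iterates of this odd polynomial map [-1, 1] to itself and converge pointwise to the
   sign function: on ]0, 1] they increase and the distance to 1 decays geometrically. *)
Definition signpoly (s : R) : R := 3 / 2 * s - 1 / 2 * (s * s * s).

(** The gaps to 1 and to -1 factor as [(1 - s)^2 (2 + s) / 2] and [(1 + s)^2 (2 - s) / 2], both
    nonnegative on [-1, 1]. *)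
Lemma signpoly_norm (s : R) : `|s| <= 1 -> `|signpoly s| <= 1.
Proof.
rewrite !ler_norml => /andP[h1 h2].
have e1 : 1 - signpoly s = (1 - s) ^+ 2 * (2 + s) / 2 by rewrite /signpoly; field.
have e2 : signpoly s + 1 = (1 + s) ^+ 2 * (2 - s) / 2 by rewrite /signpoly; field.
by apply/andP; split; [rewrite -subr_ge0 opprK e2|rewrite -subr_ge0 e1];
  rewrite divr_ge0// mulr_ge0 ?sqr_ge0//; lra.
Qed.

Lemma iter_signpoly_norm n (s : R) : `|s| <= 1 -> `|iter n signpoly s| <= 1.
Proof. by move=> s1; elim: n => //= n; exact: signpoly_norm. Qed.

Lemma iter_signpolyN n (s : R) : iter n signpoly (- s) = - iter n signpoly s.
Proof. by elim: n => //= n ->; rewrite /signpoly; ring. Qed.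

(** With [t] the current iterate, the gap [1 - t] is multiplied by [1 - (t + t^2) / 2], which is at
    most [1 - s / 2] because [t >= s]. *)
Lemma iter_signpoly_gt0 n (s : R) : 0 < s <= 1 ->
  s <= iter n signpoly s <= 1 /\ 1 - iter n signpoly s <= (1 - s / 2) ^+ n.
Proof.
move=> /andP[s0 s1]; elim: n => [|n [/andP[h1 h2] h3]] /=.
  by rewrite expr0 lexx s1; split => //; lra.
set t := iter n signpoly s in h1 h2 h3 *.
have e : 1 - signpoly t = (1 - t) * (1 - (t + t * t) / 2).
  by rewrite /signpoly; field.
have e2 : signpoly t - t = t * (1 - t) * (1 + t) / 2 by rewrite /signpoly; field.
have e3 : 0 <= (1 - t) * (1 - (t + t * t) / 2) by apply: mulr_ge0; nra.
split.
  rewrite -subr_ge0 in h1; apply/andP; split; last by rewrite -subr_ge0 e.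
  rewrite -[leRHS](subrK t) e2 (le_trans (_ : s <= t))//; first by rewrite -subr_ge0.
  by rewrite lerDr divr_ge0// !mulr_ge0; lra.
rewrite e exprS mulrC; apply: ler_pM => //; nra.
Qed.

(** The geometric bound settles [s > 0], oddness settles [s < 0], and 0 is fixed; [(l + l^2) / 2]
    sends the limits 1, -1, 0 to 1, 0, 0. *)
Lemma iter_signpoly_cvg (s : R) : `|s| <= 1 ->
  (iter n signpoly s + iter n signpoly s * iter n signpoly s) / 2
    @[n --> \oo] --> ((0 < s)%R%:R : R).
Proof.
have pos t : 0 < t <= 1 -> iter n signpoly t @[n --> \oo] --> (1 : R).
  move=> t01.
  have : 1 - (1 - t / 2) ^+ n @[n --> \oo] --> (1 - 0 : R).
    apply: cvgB; first exact: cvg_cst.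
    by apply: cvg_expr; rewrite ger0_norm; lra.
  rewrite subr0 => h; apply: (squeeze_cvgr _ h (cvg_cst _)).
  apply: nearW => n; have [/andP[_ h1 h2]] := iter_signpoly_gt0 n t01.
  by rewrite h1 andbT; lra.
have lim (u : nat -> R) (l : R) : u n @[n --> \oo] --> l ->
    (u n + u n * u n) / 2 @[n --> \oo] --> (l + l * l) / 2.
  by move=> ul; apply: cvgMr_tmp; apply: cvgD => //; exact: cvgM.
rewrite ler_norml => /andP[sN1 s1].
have [s0|s0|s0] := ltgtP 0 s.
- have -> : true%:R = (1 + 1 * 1) / 2 :> R by rewrite mulr1 divff// -[_ + _]/(2%:R) pnatr_eq0.
  by apply: lim; apply: pos; rewrite s0.
- have -> : false%:R = (- 1 + - 1 * - 1) / 2 :> R by rewrite mulrNN mulr1 addNr mul0r.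
  apply: lim.
  rewrite (_ : (fun n => _) = fun n => - iter n signpoly (- s)); last first.
    by apply/funext => n; rewrite iter_signpolyN opprK.
  by apply: cvgN; apply: pos; lra.
- have e n : iter n signpoly 0 = 0.
    by elim: n => //= n ->; rewrite /signpoly !mulr0 subr0.
  rewrite -s0; under eq_cvg do rewrite e mulr0 addr0 mul0r.
  exact: cvg_cst.
Qed.

End SignPolynomial.

Section PositivityClosure.
Context (R : realType) (T : Type) (N : (T -> R) -> Prop).
(** [N] stays abstract because the argument runs twice: for annihilators on a general measure space,
    and for annihilators on the line with bounded support. *)
Hypothesis Nlin : forall a b u v, N u -> N v -> N (fun x => a * u x + b * v x).
Hypothesis Nlim : forall u (m_ : nat -> T -> R) m, N u ->
  (forall n x, `|m_ n x| <= 1) -> (forall n, N (fun x => u x * m_ n x)) ->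
  (forall x, m_ n x @[n --> \oo] --> m x) -> N (fun x => u x * m x).

(* [(sgn + sgn^2) / 2] is the indicator of the positive reals. *)
Lemma mul_pos_closed (s : T -> R) : (forall x, `|s x| <= 1) ->
  (forall u, N u -> N (fun x => u x * s x)) ->
  forall u, N u -> N (fun x => u x * (0 < s x)%R%:R).
Proof.
move=> s1 Ns.
have it n : forall u, N u -> N (fun x => u x * iter n (@signpoly R) (s x)).
  elim: n => [|n ih] u Nu; first exact: Ns.
  (* [ih] ranges over all functions, so three applications multiply by the cube of the iterate. *)
  have := Nlin (3 / 2) (- (1 / 2)) (ih _ Nu) (ih _ (ih _ (ih _ Nu))).
  by congr N; apply/funext => x; rewrite /= /signpoly; ring.
move=> u Nu; apply: (Nlim (m_ := fun n x =>
  (iter n (@signpoly R) (s x) + iter n (@signpoly R) (s x) * iter n (@signpoly R) (s x)) / 2)) => //.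
- move=> n x; have := iter_signpoly_norm n (s1 x).
  by rewrite !ler_norml => /andP[h1 h2]; apply/andP; split; nra.
- move=> n; have := Nlin (1 / 2) (1 / 2) (it n _ Nu) (it n _ (it n _ Nu)).
  by congr N; apply/funext => x /=; field.
- by move=> x; exact: iter_signpoly_cvg.
Qed.

End PositivityClosure.

(** * Functions whose transform vanishes on a set of frequencies *)

Section Annihilator.
Context d (T : measurableType d) (R : realType) (mu : {measure set T -> \bar R}).
Variables (X : set R) (theta : T -> R).
Hypothesis mtheta : measurable_fun setT theta.

(** The real form of [int u exp(i x theta) = 0] for [x] in [X]. A general measure and phase cover
    both the line with [theta = id] and the plane with a multiple of the sum of the coordinates. *)
Definition ann (u : T -> R) := rint mu u /\ forall x, X x ->
  (\int[mu]_t (u t * cos (x * theta t))) = 0 /\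
  (\int[mu]_t (u t * sin (x * theta t))) = 0.

Lemma measurable_cosM x : measurable_fun setT (fun t => cos (x * theta t)).
Proof.
apply: (measurableT_comp (f := @cos R)); last exact: measurable_funM.
by apply: continuous_measurable_fun; exact: continuous_cos.
Qed.

Lemma measurable_sinM x : measurable_fun setT (fun t => sin (x * theta t)).
Proof.
apply: (measurableT_comp (f := @sin R)); last exact: measurable_funM.
by apply: continuous_measurable_fun; exact: continuous_sin.
Qed.

Lemma cos_norm (x : R) : `|cos x| <= 1.
Proof. by rewrite ler_norml cos_geN1 cos_le1. Qed.

Lemma sin_norm (x : R) : `|sin x| <= 1.
Proof. by rewrite ler_norml sin_geN1 sin_le1. Qed.

Lemma rint_cosM u x : rint mu u -> rint mu (fun t => u t * cos (x * theta t)).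
Proof. by apply: (@rint_bmul _ _ _ mu 1); [exact: measurable_cosM|move=> ?; exact: cos_norm]. Qed.

Lemma rint_sinM u x : rint mu u -> rint mu (fun t => u t * sin (x * theta t)).
Proof. by apply: (@rint_bmul _ _ _ mu 1); [exact: measurable_sinM|move=> ?; exact: sin_norm]. Qed.

Lemma ann_lin a b u v : ann u -> ann v -> ann (fun t => a * u t + b * v t).
Proof.
move=> [ui Hu] [vi Hv]; split; first by apply: rintD; exact: rintZ.
move=> x Xx; have [cu su] := Hu x Xx; have [cv sv] := Hv x Xx.
by split; under eq_Rintegral do rewrite mulrDl -!mulrA;
  rewrite RintegralD ?RintegralZl ?cu ?cv ?su ?sv ?mulr0 ?addr0//;
  do ?[exact: rint_cosM|exact: rint_sinM|apply: rintZ].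
Qed.

Lemma ann_lim u (m_ : nat -> T -> R) m : ann u ->
  (forall n x, `|m_ n x| <= 1) -> (forall n, ann (fun x => u x * m_ n x)) ->
  (forall x, m_ n x @[n --> \oo] --> m x) -> ann (fun x => u x * m x).
Proof.
move=> [ui _] m1 um mm.
(* Everything is dominated by [|u|]; the kernel [k = 1] yields integrability, the cosine and the
   sine yield the two vanishing integrals. *)
have dom (k : T -> R) : (forall n, rint mu (fun t => u t * m_ n t * k t)) ->
    (forall t, `|k t| <= 1) ->
    rint mu (fun t => u t * m t * k t) /\
    (\int[mu]_t (u t * m_ n t * k t)) @[n --> \oo] -->
    (\int[mu]_t (u t * m t * k t)).
  move=> ki k1; apply: (Rint_dominated (g := fun t => `|u t|)).
  - by move=> n; apply: rint_measurable; exact: ki.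
  - exact: integrable_norm.
  - move=> n t; rewrite !normrM -mulrA -[leRHS]mulr1 ler_wpM2l// mulr_ile1//.
  - by move=> t; apply: cvgMr_tmp; apply: cvgMl_tmp; exact: mm.
have umi n : rint mu (fun t => u t * m_ n t) by have [] := um n.
split.
  have [] := dom (fun=> 1).
  - by move=> n; apply: eq_rint (umi n) => t; rewrite mulr1.
  - by move=> t; rewrite normr1.
  - by move=> h _; apply: eq_rint h => t; rewrite mulr1.
move=> x Xx; split.
- have [|t|_] := dom (fun t => cos (x * theta t)).
  + by move=> n; exact: rint_cosM.
  + exact: cos_norm.
  + by apply: cvg_eq_cst; apply: nearW => n; have [] := (um n).2 x Xx.
- have [|t|_] := dom (fun t => sin (x * theta t)).
  + by move=> n; exact: rint_sinM.
  + exact: sin_norm.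
  + by apply: cvg_eq_cst; apply: nearW => n; have [] := (um n).2 x Xx.
Qed.

End Annihilator.

(** * Uniqueness of Fourier coefficients *)

Section TrigBounds.
Variable R : realType.
Implicit Types a b x : R.

Lemma mvt_lipschitz (f df : R -> R) a b :
  (forall x, is_derive x 1 f (df x)) -> (forall x, `|df x| <= 1) ->
  `|f a - f b| <= `|a - b|.
Proof.
move=> fdf df1; wlog ab : a b / b <= a.
  by move=> h; have [/h//|/ltW/h] := leP b a; rewrite distrC [leRHS]distrC.
have [|c _ ->] := @MVT_segment _ f df b a ab.
  apply: continuous_subspaceT => x.
  by apply/differentiable_continuous/derivable1_diffP; have [] := fdf x.
by rewrite normrM ler_piMl.
Qed.

Lemma cos_lipschitz a b : `|cos a - cos b| <= `|a - b|.
Proof.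
apply: (@mvt_lipschitz _ (fun x => - sin x)) => x.
by rewrite normrN sin_max.
Qed.

Lemma sin_lipschitz a b : `|sin a - sin b| <= `|a - b|.
Proof. by apply: (@mvt_lipschitz _ (@cos R)) => x; exact: cos_norm. Qed.

Lemma sin_dist x : `|sin x| <= `|x|.
Proof. by have := sin_lipschitz x 0; rewrite sin0 !subr0. Qed.

Lemma sinB x a : sin (x - a) = sin x * cos a - cos x * sin a.
Proof. by rewrite sinD sinN cosN mulrN. Qed.

Lemma cosB x a : cos (x - a) = cos x * cos a + sin x * sin a.
Proof. by rewrite cosD sinN cosN mulrN opprK. Qed.

Lemma sin_gt0_iff x : - pi < x < pi -> (0 < sin x) = (0 < x).
Proof.
move=> /andP[h1 h2]; have [x0|x0|<-] := ltgtP 0 x.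
- by rewrite sin_gt0_pi// x0.
- by apply/negbTE; rewrite -leNgt -oppr_ge0 -sinN ltW// sin_gt0_pi//; lra.
- by rewrite sin0 ltxx.
Qed.

End TrigBounds.

Section FourierUniqueness.
Context d (T : measurableType d) (R : realType) (mu : {measure set T -> \bar R}).
Variables (X : set R) (theta : T -> R).
Hypothesis mtheta : measurable_fun setT theta.
Hypothesis X1 : forall x, X x -> X (x + 1) /\ X (x - 1).
Hypothesis X0 : X 0.
Local Notation ann := (ann mu X theta).

(** By the product-to-sum formulas the kernels become half differences of those at [x + 1] and
    [x - 1], both in [X]. *)
Lemma ann_sin u : ann u -> ann (fun t => u t * sin (theta t)).
Proof.
move=> [ui Hu]; split.
  by have := rint_sinM mtheta 1 ui; apply: eq_rint => t; rewrite mul1r.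
move=> x /X1[/Hu[c1 s1] /Hu[c2 s2]]; split.
- transitivity (\int[mu]_t (2^-1 * (u t * sin ((x + 1) * theta t)) +
      - 2^-1 * (u t * sin ((x - 1) * theta t)))).
    apply: eq_Rintegral => t _; rewrite [(x + 1) * _]mulrDl [(x - 1) * _]mulrBl mul1r sinB sinD; by field.
  by rewrite RintegralD ?RintegralZl ?s1 ?s2 ?mulr0 ?addr0//;
    do ?apply: rintZ; exact: rint_sinM.
- transitivity (\int[mu]_t (2^-1 * (u t * cos ((x - 1) * theta t)) +
      - 2^-1 * (u t * cos ((x + 1) * theta t)))).
    apply: eq_Rintegral => t _; rewrite [(x + 1) * _]mulrDl [(x - 1) * _]mulrBl mul1r cosB cosD; by field.
  by rewrite RintegralD ?RintegralZl ?c1 ?c2 ?mulr0 ?addr0//;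
    do ?apply: rintZ; exact: rint_cosM.
Qed.

Lemma ann_cos u : ann u -> ann (fun t => u t * cos (theta t)).
Proof.
move=> [ui Hu]; split.
  by have := rint_cosM mtheta 1 ui; apply: eq_rint => t; rewrite mul1r.
move=> x /X1[/Hu[c1 s1] /Hu[c2 s2]]; split.
- transitivity (\int[mu]_t (2^-1 * (u t * cos ((x + 1) * theta t)) +
      2^-1 * (u t * cos ((x - 1) * theta t)))).
    apply: eq_Rintegral => t _; rewrite [(x + 1) * _]mulrDl [(x - 1) * _]mulrBl mul1r cosB cosD; by field.
  by rewrite RintegralD ?RintegralZl ?c1 ?c2 ?mulr0 ?addr0//;
    do ?apply: rintZ; exact: rint_cosM.
- transitivity (\int[mu]_t (2^-1 * (u t * sin ((x + 1) * theta t)) +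
      2^-1 * (u t * sin ((x - 1) * theta t)))).
    apply: eq_Rintegral => t _; rewrite [(x + 1) * _]mulrDl [(x - 1) * _]mulrBl mul1r sinB sinD; by field.
  by rewrite RintegralD ?RintegralZl ?s1 ?s2 ?mulr0 ?addr0//;
    do ?apply: rintZ; exact: rint_sinM.
Qed.

(** [sin (theta - a)] is a linear combination of [sin theta] and [cos theta], hence an admissible
    multiplier, and so is the indicator of the set where it is positive. *)
Lemma ann_halfcircle a u : ann u ->
  ann (fun t => u t * (0 < sin (theta t - a))%R%:R).
Proof.
apply: (mul_pos_closed (N := ann) (ann_lin mtheta) (ann_lim mtheta)
  (s := fun t => sin (theta t - a))) => [t|v Hv]; first exact: sin_norm.
have := ann_lin mtheta (cos a) (- sin a) (ann_sin Hv) (ann_cos Hv).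
by congr ann; apply/funext => t; rewrite sinB; ring.
Qed.

(* An arc ]a, pi[ is cut out of the circle by half circles. *)
Lemma ann_gt a u : (forall t, u t != 0 -> - pi < theta t < pi) ->
  - pi <= a < pi -> ann u -> ann (fun t => u t * (a < theta t)%R%:R).
Proof.
move=> upi /andP[+ api] Hu; rewrite le_eqVlt => /predU1P[<-|pia].
  move: (Hu); congr ann; apply/funext => t.
  by have [->|/upi/andP[-> _]] := eqVneq (u t) 0; rewrite ?mul0r ?mulr1.
have H0 := ann_halfcircle 0 Hu; have Ha := ann_halfcircle a Hu.
have H0a := ann_halfcircle a H0.
(* On ]-pi, pi[ the set [theta > a] is the intersection of the half circles based at 0 and at [a]
   when [a >= 0]; when [a < 0] it is their union, whose indicator is the sum minus the product. *)
have [a0|a0] := leP 0 a.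
- move: H0a; congr ann; apply/funext => t.
  have [->|/upi tpi] := eqVneq (u t) 0; first by rewrite !mul0r.
  rewrite subr0 sin_gt0_iff// -mulrA; congr (_ * _).
  have [t0|t0] := ltP 0 (theta t).
    by rewrite mul1r sin_gt0_iff ?subr_gt0//; move: tpi => /andP[? ?]; lra.
  by rewrite mul0r ltNge (le_trans t0 a0).
- have := ann_lin mtheta 1 (-1) (ann_lin mtheta 1 1 H0 Ha) H0a.
  congr ann; apply/funext => t.
  have [->|/upi tpi] := eqVneq (u t) 0; first by rewrite !(mul0r, mulr0, addr0).
  rewrite !mul1r subr0 sin_gt0_iff// -!mulrA mulN1r -mulrDr -mulrBr; congr (_ * _).
  have [t0|t0] := ltP 0 (theta t).
    by rewrite mul1r (lt_trans a0 t0) addrK.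
  rewrite (_ : false%:R = 0)// mul0r add0r subr0 sin_gt0_iff ?subr_gt0//; move: tpi => /andP[? ?]; lra.
Qed.

Variable u : T -> R.
Hypothesis upi : forall t, u t != 0 -> - pi < theta t < pi.
Hypothesis annu : ann u.

Section Step.
Variables (g : R -> R) (L : R).
Hypothesis gL : forall a b, `|g a - g b| <= L * `|a - b|.
Variable delta : R.
Hypothesis delta0 : 0 <= delta.

Let node (k : nat) : R := - pi + delta *+ k.

(** A staircase written as a telescoping sum of jumps: each jump multiplies the indicator of a half
    line, to which [ann_gt] applies. On each cell it takes the value of [g] at the right end. *)
Definition stepfun (j : nat) (x : R) : R :=
  g (- pi) + \sum_(k < j) (g (node k.+1) - g (node k)) * (node k < x)%R%:R.

(** The induction needs both cases: beyond the last node the sum has telescoped, and up to it the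
    error is that of one step of length [delta]. *)
Lemma stepfunP j x : - pi < x ->
  if node j < x then stepfun j x = g (node j)
  else `|stepfun j x - g x| <= L * delta.
Proof.
move=> pix; have L0 : 0 <= L.
  by have := gL 1 0; rewrite subr0 normr1 mulr1; exact: le_trans.
elim: j => [|j ih].
  by rewrite /stepfun big_ord0 addr0 /node mulr0n addr0 pix.
rewrite /stepfun big_ord_recr/= addrA -/(stepfun j x).
have nS : node j.+1 = node j + delta by rewrite /node mulrS; ring.
case: ifPn ih => [jx ->|jx ih].
  rewrite mulr1 addrC subrK; case: ifPn => // ; rewrite -leNgt => xj.
  rewrite (le_trans (gL _ _))// ler_wpM2l// ger0_norm; lra.
rewrite mulr0 addr0 ifF//; apply/negbTE; apply: contra jx; apply: le_lt_trans.
by rewrite nS lerDl.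
Qed.

Lemma Rint_stepfun j : (forall k, (k < j)%N -> node k < pi) ->
  rint mu (fun t => u t * stepfun j (theta t)) /\
  (\int[mu]_t (u t * stepfun j (theta t))) = 0.
Proof.
(* Frequency 0, which lies in [X], gives the plain integral. *)
have annI v : ann v -> (\int[mu]_t v t) = 0.
  case=> _ /(_ _ X0)[+ _] => <-.
  by apply: eq_Rintegral => t _; rewrite mul0r cos0 mulr1.
elim: j => [_|j ih H].
  rewrite /stepfun; under eq_fun do rewrite big_ord0 addr0 mulrC.
  rewrite RintegralZl ?annI ?mulr0//; last exact: annu.1.
  by split=> //; apply: rintZ; exact: annu.1.
have [i1 e1] := ih (fun k kj => H k (ltnW kj)).
have /(ann_gt upi)/(_ annu) A : - pi <= node j < pi.
  by rewrite H// lerDl mulrn_wge0.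
pose c := g (node j.+1) - g (node j).
have E t : u t * stepfun j.+1 (theta t) = u t * stepfun j (theta t) +
    c * (u t * (node j < theta t)%R%:R).
  by rewrite /stepfun big_ord_recr/= addrA mulrDr; congr (_ + _); rewrite /c; ring.
split; first by apply: eq_rint (rintD i1 (rintZ c A.1)) => t; rewrite E.
under eq_Rintegral do rewrite E.
by rewrite RintegralD ?RintegralZl ?e1 ?annI ?mulr0 ?addr0//;
  [exact: A.1|apply: rintZ; exact: A.1].
Qed.

End Step.

Lemma ann_lipschitz (g : R -> R) L : (forall a b, `|g a - g b| <= L * `|a - b|) ->
  rint mu (fun t => u t * g (theta t)) ->
  (\int[mu]_t (u t * g (theta t))) = 0.
Proof.
move=> gL ui; apply/eqP; rewrite -normr_le0; apply/ler_addgt0Pl => e e0.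
rewrite addr0.
have L0 : 0 <= L by have := gL 1 0; rewrite subr0 normr1 mulr1; exact: le_trans.
pose A := \int[mu]_t `|u t|; have A0 : 0 <= A by exact: Rintegral_ge0.
(* [M] exceeds [A L 2 pi / e], so that steps of length [2 pi / M] cost at most [e] in the
   integral. *)
pose M := (Num.truncn (A * L * (2 * pi) / e)).+1.
pose del := 2 * pi / M%:R : R.
have M0 : (0 : R) < M%:R by rewrite ltr0n.
have pi0 := pi_gt0 R.
have del0 : 0 < del by rewrite divr_gt0// mulr_gt0.
have delM : del *+ M = 2 * pi by rewrite -[del *+ M]mulr_natr /del divfK// gt_eqF.
have [|si s0] := Rint_stepfun g (ltW del0) (j := M).
  move=> k kM; have : del *+ k < del *+ M by rewrite ltr_pMn2l.
  by rewrite delM; lra.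
rewrite -[X in `|X|]subr0 -s0 -RintegralB//.
apply: (le_trans (le_normr_Rintegral measurableT (rintB ui si))).
have ni := integrable_norm annu.1.
apply: (@le_trans _ _ (\int[mu]_t (L * del * `|u t|))).
  apply: le_Rintegral => //.
  - exact: integrable_norm (rintB ui si).
  - exact: rintZ.
  - move=> t _; rewrite -mulrBr normrM mulrC.
    have [->|/upi/andP[t1 t2]] := eqVneq (u t) 0; first by rewrite normr0 !mulr0.
    rewrite ler_wpM2r//.
    (* The last node is exactly [pi], which [theta t] does not pass, so the error bound is the case
       that applies. *)
    have := stepfunP gL (ltW del0) M t1; rewrite delM ifF; first by rewrite distrC.
    by apply/negbTE; rewrite -leNgt; lra.
rewrite RintegralZl// -/A.
have : A * L * (2 * pi) / e < M%:R by rewrite truncnS_gt.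
rewrite ltr_pdivrMr// => h.
have -> : L * del * A = A * L * (2 * pi) / M%:R by rewrite /del; field; rewrite gt_eqF.
by rewrite ler_pdivrMr// [leRHS]mulrC ltW.
Qed.

(** As functions of [y], [cos (x y)] and [sin (x y)] are Lipschitz with constant [|x|], so vanishing
    at the frequencies in [X] spreads to every real one. *)
Lemma ann_all x : (\int[mu]_t (u t * cos (x * theta t))) = 0 /\
  (\int[mu]_t (u t * sin (x * theta t))) = 0.
Proof.
have ui := annu.1; split.
- apply: (ann_lipschitz (g := fun y => cos (x * y)) (L := `|x|)); last exact: rint_cosM.
  by move=> a b; rewrite (le_trans (cos_lipschitz _ _))// -mulrBr normrM.
- apply: (ann_lipschitz (g := fun y => sin (x * y)) (L := `|x|)); last exact: rint_sinM.
  by move=> a b; rewrite (le_trans (sin_lipschitz _ _))// -mulrBr normrM.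
Qed.

End FourierUniqueness.

(** * Transforms vanishing on an interval *)

Section LocalUniqueness.
Variable R : realType.
Local Notation mu := (@lebesgue_measure R).

(** By the mean value theorem the difference is [(cos c - 1) y], with [|cos c - 1| <= c <= y] for
    [y >= 0]. *)
Lemma sin_sub_le (y : R) : `|sin y - y| <= y ^+ 2.
Proof.
have h : forall x : R, is_derive x 1 (fun z : R => sin z - z) (cos x - 1).
  by move=> x; apply: is_deriveB.
wlog y0 : y / 0 <= y.
  move=> H; have [/H//|/ltW y0] := leP 0 y.
  have := H (- y); rewrite oppr_ge0 sinN sqrrN => /(_ y0).
  by rewrite -opprD normrN.
have [|c + ] := @MVT_segment _ _ _ 0 y y0 (fun x _ => h x).
  apply: continuous_subspaceT => x.
  by apply/differentiable_continuous/derivable1_diffP; have [] := h x.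
rewrite in_itv/= => /andP[c0 cy]; rewrite sin0 !subr0 => ->.
rewrite normrM (ger0_norm y0) expr2 ler_wpM2r// (le_trans _ cy)//.
have := cos_lipschitz c 0; rewrite cos0 subr0 (ger0_norm c0); exact.
Qed.

(** The error at [n] is at most [(n + 1) (t / (n + 1))^2 = t^2 / (n + 1)]. *)
Lemma cvg_sin_scaled (t : R) : n.+1%:R * sin (t / n.+1%:R) @[n --> \oo] --> t.
Proof.
have h : t ^+ 2 * harmonic n @[n --> \oo] --> (0 : R).
  by rewrite -[X in _ --> X](mulr0 (t ^+ 2)); apply: cvgMl_tmp; exact: cvg_harmonic.
have lo : t - t ^+ 2 * harmonic n @[n --> \oo] --> t.
  by rewrite -[X in _ --> X]subr0; apply: cvgB => //; exact: cvg_cst.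
have hi : t + t ^+ 2 * harmonic n @[n --> \oo] --> t.
  by rewrite -[X in _ --> X]addr0; apply: cvgD => //; exact: cvg_cst.
apply: (squeeze_cvgr _ lo hi); apply: nearW => n.
have k0 : (0 : R) < n.+1%:R by rewrite ltr0n.
have := sin_sub_le (t / n.+1%:R).
rewrite -(ler_pM2l k0) -[X in X * `|_|](gtr0_norm k0) -normrM mulrBr.
have -> : n.+1%:R * (t / n.+1%:R) = t by rewrite mulrC divfK// gt_eqF.
have -> : n.+1%:R * (t / n.+1%:R) ^+ 2 = t ^+ 2 * harmonic n.
  by rewrite /harmonic/=; field; rewrite gt_eqF.
by rewrite ler_distl.
Qed.

Variables (A delta : R).
Hypothesis delta0 : 0 < delta.
Local Notation X := [set x : R | `|x| < delta].
Local Notation annX := (ann mu X id).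
Let mid : measurable_fun setT (@id R).
Proof. exact: measurable_id. Qed.

(** The bounded support controls the unbounded multiplier [t], as [|t| <= A] wherever [u] is
    nonzero. *)
Let N (u : R -> R) := annX u /\ forall t, u t != 0 -> `|t| <= A.

Let N_lin a b u v : N u -> N v -> N (fun t => a * u t + b * v t).
Proof.
move=> [au su] [av sv]; split; first exact: ann_lin.
move=> t; have [ut|/su//] := eqVneq (u t) 0.
have [vt|/sv//] := eqVneq (v t) 0.
by rewrite ut vt !mulr0 addr0 eqxx.
Qed.

Let N_mul_supp u (m : R -> R) : N u -> forall t, u t * m t != 0 -> `|t| <= A.
Proof. by move=> [_ su] t; have [->|/su//] := eqVneq (u t) 0; rewrite mul0r eqxx. Qed.

Let N_lim u (m_ : nat -> R -> R) m : N u ->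
  (forall n x, `|m_ n x| <= 1) -> (forall n, N (fun x => u x * m_ n x)) ->
  (forall x, m_ n x @[n --> \oo] --> m x) -> N (fun x => u x * m x).
Proof.
move=> Nu m1 um mm; split; last exact: N_mul_supp.
apply: (@ann_lim _ _ _ mu X id mid u m_ m Nu.1 m1) => [n|//].
exact: (um n).1.
Qed.

Lemma near_frequencies (x : R) : `|x| < delta ->
  \forall n \near \oo, `|x + n.+1%:R^-1| < delta /\ `|x - n.+1%:R^-1| < delta.
Proof.
move=> xd; have d0 : 0 < delta - `|x| by rewrite subr_gt0.
have /cvgr0Pnorm_lt/(_ _ d0) := @cvg_harmonic R.
apply: filterS => n; rewrite /harmonic/= => h.
split; [apply: (le_lt_trans (ler_normD _ _))|apply: (le_lt_trans (ler_normB _ _))];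
  lra.
Qed.

(* [u t * t] is a limit of [u t * (k * sin (t / k))], and multiplication by [sin (t / k)]
   shifts frequencies by at most [1 / k]. *)
Let N_id u : N u -> N (fun t => u t * t).
Proof.
move=> Nu; have [[ui Hu] su] := Nu; split; last exact: N_mul_supp.
have mu_ := rint_measurable ui.
have gi : rint mu (fun t => A * `|u t|) by apply: rintZ; exact: integrable_norm.
have bnd t (m : R) : `|m| <= `|t| -> `|u t * m| <= A * `|u t|.
  move=> mt; rewrite normrM mulrC.
  have [->|/su tA] := eqVneq (u t) 0; first by rewrite normr0 !mulr0.
  by rewrite ler_wpM2r// (le_trans mt).
have mk n : measurable_fun setT (fun t : R => n.+1%:R * sin (t / n.+1%:R)).
  apply: measurable_funM => //; under eq_fun do rewrite mulrC.
  exact: measurable_sinM.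
have bk n (t : R) : `|n.+1%:R * sin (t / n.+1%:R)| <= `|t|.
  have k0 : (0 : R) < n.+1%:R by rewrite ltr0n.
  rewrite normrM (le_trans (ler_wpM2l _ (sin_dist _)))// normrM mulrC.
  by rewrite -mulrA -normrM mulVf ?gt_eqF// normr1 mulr1.
split.
  apply: (@rint_dom _ _ R mu (fun t => A * `|u t|) (fun t => u t * t) _ _ gi).
    exact: measurable_funM.
  by move=> t; exact: bnd.
move=> x Xx.
(* The multipliers [k sin (t / k)] are bounded by [|t|], so [A |u|] dominates uniformly and the zero
   integrals pass to the limit. *)
have key (c : R -> R) : measurable_fun setT c -> (forall t, `|c t| <= 1) ->
    (\forall n \near \oo, \int[mu]_t (u t * (n.+1%:R * sin (t / n.+1%:R)) * c t) = 0) ->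
    (\int[mu]_t (u t * t * c t)) = 0.
  move=> mc c1 h0; apply: (cvg_eq_cst h0).
  apply: (@Rint_dominated _ _ R mu
    (fun n t => u t * (n.+1%:R * sin (t / n.+1%:R)) * c t)
    (fun t => u t * t * c t) _ _ gi _ _).2.
  - by move=> n; exact: (measurable_funM (measurable_funM mu_ (mk n)) mc).
  - move=> n t; rewrite -mulrA; apply: bnd; rewrite normrM.
    by rewrite (le_trans _ (bk n t))// ler_piMr.
  - move=> t; apply: cvgMr_tmp; apply: cvgMl_tmp; exact: cvg_sin_scaled.
split; apply: key.
- exact: measurable_cosM.
- by move=> t; exact: cos_norm.
- move: (near_frequencies Xx); apply: filterS => n [/Hu[_ s1] /Hu[_ s2]].
  transitivity (\int[mu]_t (n.+1%:R / 2 * (u t * sin ((x + n.+1%:R^-1) * t)) +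
      - (n.+1%:R / 2) * (u t * sin ((x - n.+1%:R^-1) * t)))).
    apply: eq_Rintegral => t _.
    rewrite [(x + _) * _]mulrDl [(x - _) * _]mulrBl sinB sinD [_^-1 * t]mulrC.
    by field.
  by rewrite RintegralD ?RintegralZl ?s1 ?s2 ?mulr0 ?addr0//;
    do ?apply: rintZ; exact: rint_sinM.
- exact: measurable_sinM.
- by move=> t; exact: sin_norm.
- move: (near_frequencies Xx); apply: filterS => n [/Hu[c1 _] /Hu[c2 _]].
  transitivity (\int[mu]_t (n.+1%:R / 2 * (u t * cos ((x - n.+1%:R^-1) * t)) +
      - (n.+1%:R / 2) * (u t * cos ((x + n.+1%:R^-1) * t)))).
    apply: eq_Rintegral => t _.
    rewrite [(x - _) * _]mulrBl [(x + _) * _]mulrDl cosB cosD [_^-1 * t]mulrC.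
    by field.
  by rewrite RintegralD ?RintegralZl ?c1 ?c2 ?mulr0 ?addr0//;
    do ?apply: rintZ; exact: rint_cosM.
Qed.

Let N_gt a u : N u -> N (fun t => u t * (a < t)%R%:R).
Proof.
(* [k] exceeds [|t - a|] on the support, so [s] is [t - a] rescaled into [-1, 1] and cut off
   outside, with the sign of [t - a] where [u] is nonzero. *)
move=> Nu; pose k := `|A| + `|a| + 1.
have k0 : 0 < k by rewrite /k; have := normr_ge0 A; have := normr_ge0 a; lra.
pose s (t : R) := if `|t| <= A then (t - a) / k else 0.
have s1 t : `|s t| <= 1.
  rewrite /s; case: ifPn => [tA|_]; last by rewrite normr0.
  rewrite normrM normfV (gtr0_norm k0) ler_pdivrMr// mul1r /k.
  by rewrite (le_trans (ler_normB _ _))//; have := ler_norm A; lra.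
have Ns v : N v -> N (fun t => v t * s t).
  move=> Nv; have := N_lin (k^-1) (- a / k) (N_id Nv) Nv.
  congr N; apply/funext => t; rewrite /s.
  have [->|/Nv.2 ->] := eqVneq (v t) 0; first by rewrite !mul0r !mulr0 addr0.
  by field; rewrite gt_eqF.
have := mul_pos_closed N_lin N_lim s1 Ns Nu.
congr N; apply/funext => t.
have [->|/Nu.2 tA] := eqVneq (u t) 0; first by rewrite !mul0r.
by rewrite /s tA pmulr_lgt0 ?invr_gt0// subr_gt0.
Qed.

(** At frequency 0, [N_gt] makes the integrals of [u] over all half lines vanish; Lebesgue
    differentiation of this zero primitive gives [u = 0] almost everywhere. *)
Lemma fourier_local_unique u : annX u -> (forall t, u t != 0 -> `|t| <= A) ->
  {ae mu, forall t, u t = 0}.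
Proof.
move=> au su; have Nu : N u by [].
have annI v : annX v -> (\int[mu]_t v t) = 0.
  case=> _ /(_ 0)[|+ _]; first by rewrite /= normr0.
  by move=> <-; apply: eq_Rintegral => t _; rewrite mul0r cos0 mulr1.
have F0 x : (\int[mu]_(t in `]-oo, x]) u t) = 0.
  rewrite Rintegral_mkcond.
  transitivity (\int[mu]_t (u t - u t * (x < t)%R%:R)).
    apply: eq_Rintegral => t _; rewrite patchE/= mem_setE in_itv/=.
    by case: ltP => _; rewrite ?mulr1 ?subrr ?mulr0 ?subr0.
  have [[gi _] _] := N_gt x Nu.
  rewrite RintegralB ?annI ?subr0//; [exact: (N_gt x Nu).1|exact: au.1].
have ii : forall y : R, mu.-integrable `]-oo, y] (EFin \o u).
  by move=> y; apply: integrableS au.1.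
have := FTC1Ny ii (open_integrable_locally openT au.1).
apply: filterS; first exact: (ae_filter_ringOfSetsType mu).
move=> x [_ <-]; rewrite (_ : (fun _ => _) = cst 0) ?derive1_cst//.
by apply/funext => y; rewrite F0.
Qed.

End LocalUniqueness.

(** * Translation invariance of Lebesgue measure *)

Section Translation.
Variable R : realType.
Local Notation mu := (@lebesgue_measure R).

Lemma measurable_shift (a : R) :
  measurable_fun setT ((fun t => t + a) : measurableTypeR R -> measurableTypeR R).
Proof. by apply: measurable_funD. Qed.

(** The image measure gives half-open intervals their length, and this determines Lebesgue
    measure. *)
Lemma lebesgue_measure_shift (a : R) (B : set R) : measurable B ->
  pushforward mu ((fun t => t + a) : _ -> measurableTypeR R) B = mu B.
Proof.
move=> mB.
have mf := measurable_shift a.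
pose f : {mfun measurableTypeR R >-> measurableTypeR R} :=
  HB.pack ((fun t => t + a) : measurableTypeR R -> measurableTypeR R)
    (isMeasurableFun.Build _ _ _ _ _ mf).
apply/esym/(@lebesgue_measure_unique _ (pushforward mu f)) => //= _ [[b c]] _ <-.
rewrite /pushforward/= (_ : _ @^-1` _ = `]b - a, c - a]%classic); last first.
  by apply/seteqP; split => t /=; rewrite !in_itv/= ltrBlDr lerBrDr.
rewrite !lebesgue_measure_itv/= !lte_fin ltrD2r.
by case: ifPn => // _; rewrite -!EFinB; congr EFin; ring.
Qed.

Lemma ge0_integral_shift (a : R) (f : R -> \bar R) : measurable_fun setT f ->
  (forall t, 0 <= f t)%E -> (\int[mu]_t f (t + a)%R = \int[mu]_t f t)%E.
Proof.
move=> mf f0.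
have := ge0_integral_pushforward (measurable_shift a) mu measurableT mf (fun t _ => f0 t).
rewrite preimage_setT => <-.
apply: eq_measure_integral => [|mshift B mB _]; first exact: measurable_shift.
by have := lebesgue_measure_shift a mB.
Qed.

Lemma rint_shift (a : R) f : rint mu f -> rint mu (fun t => f (t + a)).
Proof.
move=> fi; have mf := rint_measurable fi.
apply/integrableP; split.
  by apply/measurable_EFinP; apply: (measurableT_comp mf); exact: measurable_shift.
have /integrableP[_] := fi; rewrite -(ge0_integral_shift a)//.
by apply: measurableT_comp => //; exact/measurable_EFinP.
Qed.

Lemma Rint_shift (a : R) f : rint mu f -> (\int[mu]_t f (t + a)) = \int[mu]_t f t.
Proof.
move=> fi; have mf := rint_measurable fi.
rewrite /Rintegral; congr fine.
have := @integral_pushforward _ _ _ _ R _ (measurable_shift a) mu setT (EFin \o f).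
rewrite preimage_setT => /(_ _ _ measurableT) <- //.
- apply: eq_measure_integral => [|mshift B mB _]; first exact: measurable_shift.
by have := lebesgue_measure_shift a mB.
- exact/measurable_EFinP.
- exact: rint_shift.
Qed.

End Translation.

(** * Products of transforms *)

Section ComplexPairs.
Context d (T : measurableType d) (R : realType) (mu : {measure set T -> \bar R}).
Variable theta : T -> R.
Hypothesis mtheta : measurable_fun setT theta.

(* Real and imaginary part of the integral of [(u + i w) exp(i x theta)]. *)
Definition reft (u w : T -> R) (x : R) : R :=
  \int[mu]_t (u t * cos (x * theta t) - w t * sin (x * theta t)).
Definition imft (u w : T -> R) (x : R) : R :=
  \int[mu]_t (w t * cos (x * theta t) + u t * sin (x * theta t)).

Lemma reftE u w x : rint mu u -> rint mu w ->
  reft u w x = (\int[mu]_t (u t * cos (x * theta t))) -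
               (\int[mu]_t (w t * sin (x * theta t))).
Proof. by move=> ui wi; apply: RintegralB => //; [exact: rint_cosM|exact: rint_sinM]. Qed.

Lemma imftE u w x : rint mu u -> rint mu w ->
  imft u w x = (\int[mu]_t (w t * cos (x * theta t))) +
               (\int[mu]_t (u t * sin (x * theta t))).
Proof. by move=> ui wi; apply: RintegralD => //; [exact: rint_cosM|exact: rint_sinM]. Qed.

Lemma Rint_cosN u x : (\int[mu]_t (u t * cos (- x * theta t))) =
  \int[mu]_t (u t * cos (x * theta t)).
Proof. by apply: eq_Rintegral => t _; rewrite mulNr cosN. Qed.

Lemma Rint_sinN u x : rint mu u -> (\int[mu]_t (u t * sin (- x * theta t))) =
  - \int[mu]_t (u t * sin (x * theta t)).
Proof.
move=> ui; rewrite -[RHS]mulN1r -RintegralZl//; last exact: rint_sinM.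
by apply: eq_Rintegral => t _; rewrite mulNr sinN; ring.
Qed.

(** The transform at [x] and at [-x] gives four equations; since cosine is even and sine odd, they
    separate the four integrals of [u] and [w]. *)
Lemma ann_complex (X : set R) u w : rint mu u -> rint mu w ->
  (forall x, X x -> X (- x)) ->
  (forall x, X x -> reft u w x = 0 /\ imft u w x = 0) ->
  ann mu X theta u /\ ann mu X theta w.
Proof.
move=> ui wi XN H.
have E x : X x -> [/\ (\int[mu]_t (u t * cos (x * theta t))) = 0,
    (\int[mu]_t (u t * sin (x * theta t))) = 0,
    (\int[mu]_t (w t * cos (x * theta t))) = 0 &
    (\int[mu]_t (w t * sin (x * theta t))) = 0].
  move=> Xx; have [] := H _ Xx; have [] := H _ (XN _ Xx).
  rewrite !reftE// !imftE// !Rint_cosN !Rint_sinN// => h1 h2 h3 h4.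
  by split; lra.
by split; split=> // x /E[].
Qed.

End ComplexPairs.

Section Fubini.
Variable R : realType.
Local Notation mu := (@lebesgue_measure R).
Local Notation mu2 := (mu \x mu)%E.

Lemma rint_bmulR (m u : R -> R) M : measurable_fun setT m ->
  (forall x, `|m x| <= M) -> rint mu u -> rint mu (fun x => u x * m x).
Proof. by move=> mm mM; exact: (@rint_bmul _ _ R mu M m u mm mM). Qed.

Lemma rint_cosR (u : R -> R) x : rint mu u -> rint mu (fun t => u t * cos (x * t)).
Proof. by apply: (@rint_cosM _ _ R mu id); exact: measurable_id. Qed.

Lemma rint_sinR (u : R -> R) x : rint mu u -> rint mu (fun t => u t * sin (x * t)).
Proof. by apply: (@rint_sinM _ _ R mu id); exact: measurable_id. Qed.

(** By Tonelli the integral of the absolute value is the product of two finite integrals. *)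
Lemma rint_tensor (u w : R -> R) : rint mu u -> rint mu w ->
  rint mu2 (fun z => u z.1 * w z.2).
Proof.
move=> ui wi; have mu_ := rint_measurable ui; have mw := rint_measurable wi.
have mh : measurable_fun setT (EFin \o (fun z : R * R => u z.1 * w z.2)).
  apply/measurable_EFinP; apply: measurable_funM.
    exact: (measurableT_comp mu_ measurable_fst).
  exact: (measurableT_comp mw measurable_snd).
apply: (proj2 (@integrable12ltyP _ _ _ _ R mu mu _ mh)).
have /integrableP[_ ui'] := ui; have /integrableP[_ wi'] := wi.
have mau : measurable_fun setT (fun x => (`|u x|)%:E).
  by apply/measurable_EFinP; exact: measurableT_comp.
have maw : measurable_fun setT (fun x => (`|w x|)%:E).
  by apply/measurable_EFinP; exact: measurableT_comp.
under eq_integral => x _.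
  under eq_integral => y _ do rewrite /= normrM EFinM.
  rewrite ge0_integralZl//.
  over.
rewrite /= ge0_integralZr//; last exact: integral_ge0.
apply: lte_mul_pinfty => //; first exact: integral_ge0.
by rewrite ge0_fin_numE//; exact: integral_ge0.
Qed.

Lemma rint_tensor_bounded (u w : R -> R) (k : R * R -> R) M :
  rint mu u -> rint mu w -> measurable_fun setT k -> (forall z, `|k z| <= M) ->
  rint mu2 (fun z => u z.1 * w z.2 * k z).
Proof. by move=> ui wi mk kM; apply: (@rint_bmul _ _ R mu2 M k _ mk kM); exact: rint_tensor. Qed.

(** Integrability of every section makes the inner integral finite everywhere, so Fubini for
    extended reals can be read with real integrals. *)
Lemma Rint_prod12 (h : R * R -> R) : rint mu2 h ->
  (forall x, rint mu (fun y => h (x, y))) ->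
  (\int[mu2]_z h z) = \int[mu]_x \int[mu]_y h (x, y).
Proof.
move=> hi h1; rewrite /Rintegral -integral12_prod_meas1//; congr fine.
by apply: eq_integral => x _; rewrite /fubini_F -[RHS](rint_EFin (h1 x)).
Qed.

Lemma Rint_prod21 (h : R * R -> R) : rint mu2 h ->
  (forall y, rint mu (fun x => h (x, y))) ->
  (\int[mu2]_z h z) = \int[mu]_y \int[mu]_x h (x, y).
Proof.
move=> hi h1; rewrite /Rintegral -integral21_prod_meas1//; congr fine.
by apply: eq_integral => x _; rewrite /fubini_G -[RHS](rint_EFin (h1 x)).
Qed.

Lemma Rint_tensor (u w : R -> R) : rint mu u -> rint mu w ->
  (\int[mu2]_z (u z.1 * w z.2)) = (\int[mu]_x u x) * (\int[mu]_y w y).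
Proof.
move=> ui wi; rewrite (@Rint_prod12 (fun z => u z.1 * w z.2))//=; last 2 first.
- exact: rint_tensor.
- by move=> x; exact: rintZ.
rewrite -RintegralZr//; apply: eq_Rintegral => x _.
by rewrite RintegralZl.
Qed.

(** The exchange of integrals behind Parseval: a bounded kernel keeps the tensor product integrable
    on the plane. *)
Lemma Rint_swap_kernel (u w : R -> R) (k : R * R -> R) M :
  rint mu u -> rint mu w -> measurable_fun setT k -> (forall z, `|k z| <= M) ->
  (\int[mu]_t ((\int[mu]_s (u s * k (s, t))) * w t)) =
  \int[mu]_s (u s * \int[mu]_t (w t * k (s, t))).
Proof.
move=> ui wi mk kM.
have hi := rint_tensor_bounded ui wi mk kM.
have k1 s : measurable_fun setT (fun t => k (s, t)).
  by apply: (measurableT_comp mk); exact: measurable_pair1.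
have k2 t : measurable_fun setT (fun s => k (s, t)).
  by apply: (measurableT_comp mk); exact: measurable_pair2.
transitivity (\int[mu]_t \int[mu]_s (u s * w t * k (s, t))).
  apply: eq_Rintegral => t _; rewrite -RintegralZr//.
    by apply: eq_Rintegral => s _; ring.
  exact: (rint_bmulR (k2 t) (fun s => kM _)).
rewrite -(@Rint_prod21 (fun z => u z.1 * w z.2 * k z))//; last first.
  move=> t /=; apply: (rint_bmulR (k2 t) (fun s => kM _)).
  by have := rintZ (w t) ui; apply: eq_rint => s; rewrite mulrC.
rewrite (@Rint_prod12 (fun z => u z.1 * w z.2 * k z))//; last first.
  by move=> s /=; apply: (rint_bmulR (k1 s) (fun t => kM _)); exact: rintZ.
apply: eq_Rintegral => s _ /=; rewrite -RintegralZl//.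
  by apply: eq_Rintegral => t _; rewrite mulrA.
exact: (rint_bmulR (k1 s) (fun t => kM _)).
Qed.

End Fubini.

(** * Continuity of transforms and uniqueness near an arbitrary point *)

Section Transform.
Variable R : realType.
Local Notation mu := (@lebesgue_measure R).
Local Notation reft := (reft mu id).
Local Notation imft := (imft mu id).
Let mid : measurable_fun setT (@id R).
Proof. exact: measurable_id. Qed.

Lemma continuous_transform (u c : R -> R) : rint mu u -> continuous c ->
  (forall y, `|c y| <= 1) -> continuous (fun x : R => \int[mu]_t (u t * c (x * t))).
Proof.
move=> ui cc c1 x.
have mc l : measurable_fun setT (fun t : R => c (l * t)).
  apply: (measurableT_comp (f := c)); first exact: continuous_measurable_fun.
  exact: measurable_funM.
apply: (@continuity_under_integral R _ _ mu (fun l t => u t * c (l * t)) setT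
  measurableT (x - 1) (x + 1) _ _ (fun t => `|u t|)).
- by move=> l _; exact: (rint_bmulR (mc l) (fun t => c1 _)).
- apply: aeW => t _ l _ /=.
  apply: cvgMl_tmp; apply: (cvg_comp (fun z : R => z * t) c); last exact: cc.
  by apply: cvgMr_tmp; exact: cvg_id.
- exact: integrable_norm.
- by move=> l _; apply: aeW => t _ /=; rewrite normrM ler_piMr.
- by rewrite inE/= in_itv/=; apply/andP; split; lra.
Qed.

Lemma continuous_reft u w : rint mu u -> rint mu w -> continuous (reft u w).
Proof.
move=> ui wi; have -> : reft u w = fun x => (\int[mu]_t (u t * cos (x * t))) -
    (\int[mu]_t (w t * sin (x * t))) by apply/funext => x; rewrite reftE.
move=> x; apply: cvgB.
  by apply: (continuous_transform ui) => [|y]; [exact: continuous_cos|exact: cos_norm].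
by apply: (continuous_transform wi) => [|y]; [exact: continuous_sin|exact: sin_norm].
Qed.

(** Multiplying the spectrum by [exp(i x0 t)] recentres the interval at 0, where
    [fourier_local_unique] applies to the real and the imaginary part. *)
Lemma reft_unique_near u w A (x0 delta : R) : 0 < delta ->
  rint mu u -> rint mu w ->
  (forall t, `|t| > A -> u t = 0 /\ w t = 0) ->
  (forall x, `|x - x0| < delta -> reft u w x = 0 /\ imft u w x = 0) ->
  {ae mu, forall t, u t = 0 /\ w t = 0}.
Proof.
move=> d0 ui wi supp H.
pose u' t := u t * cos (x0 * t) - w t * sin (x0 * t).
pose w' t := w t * cos (x0 * t) + u t * sin (x0 * t).
have ui' : rint mu u' by apply: rintB; [exact: rint_cosR|exact: rint_sinR].
have wi' : rint mu w' by apply: rintD; [exact: rint_cosR|exact: rint_sinR].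
have [||a1 a2] := @ann_complex _ _ _ mu id mid [set x : R | `|x| < delta] u' w' ui' wi'.
- by move=> x /=; rewrite normrN.
- move=> x /= xd; have [|h1 h2] := H (x0 + x); first by rewrite addrAC subrr add0r.
  split; [rewrite -h1|rewrite -h2]; apply: eq_Rintegral => t _;
    rewrite /u' /w' /= [(x0 + x) * _]mulrDl cosD sinD; ring.
have su t : u' t != 0 -> `|t| <= A.
  by apply: contraR; rewrite -ltNge => /supp[ut wt]; rewrite /u' ut wt !mul0r subrr.
have sw t : w' t != 0 -> `|t| <= A.
  by apply: contraR; rewrite -ltNge => /supp[ut wt]; rewrite /w' ut wt !mul0r addr0.
have := fourier_local_unique d0 a2 sw; have := fourier_local_unique d0 a1 su.
apply: filterS2 => t u0 w0.
(* The factor has modulus 1, so the squared modulus is unchanged. *)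
have e : u t ^+ 2 + w t ^+ 2 = u' t ^+ 2 + w' t ^+ 2.
  by rewrite /u' /w' -[LHS]mulr1 -(cos2Dsin2 (x0 * t)); ring.
move: e; rewrite u0 w0 expr0n addr0 => /eqP.
rewrite paddr_eq0 ?sqr_ge0// !sqrf_eq0 => /andP[/eqP-> /eqP->]; by [].
Qed.

End Transform.

(** * Band-limited transforms whose product vanishes at the sample points *)

Section ProductUniqueness.
Variables (R : realType) (B : R).
Hypothesis B0 : 0 < B.
Local Notation mu := (@lebesgue_measure R).
Local Notation mu2 := (mu \x mu)%E.
Local Notation reft := (reft mu id).
Local Notation imft := (imft mu id).
Variables P1 P2 Q1 Q2 : R -> R.
Hypotheses (P1i : rint mu P1) (P2i : rint mu P2) (Q1i : rint mu Q1) (Q2i : rint mu Q2).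
Hypothesis Psupp : forall t, `|t| >= B -> P1 t = 0 /\ P2 t = 0.
Hypothesis Qsupp : forall t, `|t| >= B -> Q1 t = 0 /\ Q2 t = 0.
Let mid : measurable_fun setT (@id R).
Proof. exact: measurable_id. Qed.

(** Real and imaginary part of [P (xi) Q (eta)] on the plane. The phase [theta] scales sums in ]-2B,
    2B[ to ]-pi, pi[, so its integer frequencies are the angular frequencies [n pi / (2B)], that is,
    the sample points [n / (4B)]. *)
Let W1 (z : R * R) := P1 z.1 * Q1 z.2 - P2 z.1 * Q2 z.2.
Let W2 (z : R * R) := P1 z.1 * Q2 z.2 + P2 z.1 * Q1 z.2.
Let theta (z : R * R) := pi / (2 * B) * (z.1 + z.2).

Let W1i : rint mu2 W1. Proof. by apply: rintB; exact: rint_tensor. Qed.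
Let W2i : rint mu2 W2. Proof. by apply: rintD; exact: rint_tensor. Qed.

Let mtheta : measurable_fun setT theta.
Proof.
apply: measurable_funM => //; apply: measurable_funD.
  exact: measurable_fst.
exact: measurable_snd.
Qed.

Let rint_re u w x : rint mu u -> rint mu w ->
  rint mu (fun t => u t * cos (x * t) - w t * sin (x * t)).
Proof. by move=> ui wi; apply: rintB; [exact: rint_cosR|exact: rint_sinR]. Qed.

Let rint_im u w x : rint mu u -> rint mu w ->
  rint mu (fun t => w t * cos (x * t) + u t * sin (x * t)).
Proof. by move=> ui wi; apply: rintD; [exact: rint_cosR|exact: rint_sinR]. Qed.

(** The addition formulas factor [exp(i y theta)] over the two coordinates, and the integral over
    the plane becomes a product of transforms. *)
Let re_mul y : let x := y * (pi / (2 * B)) in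
  (\int[mu2]_z (W1 z * cos (y * theta z) - W2 z * sin (y * theta z))) =
  reft P1 P2 x * reft Q1 Q2 x - imft P1 P2 x * imft Q1 Q2 x.
Proof.
move=> x.
have H1 := rint_re x P1i P2i; have H2 := rint_re x Q1i Q2i.
have H3 := rint_im x P1i P2i; have H4 := rint_im x Q1i Q2i.
have T1 := rint_tensor H1 H2; have T2 := rint_tensor H3 H4.
rewrite /reft /imft -!Rint_tensor// -RintegralB//.
apply: eq_Rintegral => -[s t] _ /=.
rewrite /theta/= mulrA -/x mulrDr cosD sinD /W1 /W2/=; ring.
Qed.

Let im_mul y : let x := y * (pi / (2 * B)) in
  (\int[mu2]_z (W2 z * cos (y * theta z) + W1 z * sin (y * theta z))) =
  reft P1 P2 x * imft Q1 Q2 x + imft P1 P2 x * reft Q1 Q2 x.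
Proof.
move=> x.
have H1 := rint_re x P1i P2i; have H2 := rint_re x Q1i Q2i.
have H3 := rint_im x P1i P2i; have H4 := rint_im x Q1i Q2i.
have T1 := rint_tensor H1 H4; have T2 := rint_tensor H3 H2.
rewrite /reft /imft -!Rint_tensor// -RintegralD//.
apply: eq_Rintegral => -[s t] _ /=.
rewrite /theta/= mulrA -/x mulrDr cosD sinD /W1 /W2/=; ring.
Qed.

Hypothesis Preal : forall x, imft P1 P2 x = 0.
Hypothesis Qreal : forall x, imft Q1 Q2 x = 0.
Hypothesis PQ0 : forall n : int, let x := n%:~R * (pi / (2 * B)) in
  reft P1 P2 x * reft Q1 Q2 x = 0.

Lemma mul_transform_eq0 x : reft P1 P2 x * reft Q1 Q2 x = 0.
Proof.
pose X := [set x : R | exists n : int, x = n%:~R].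
have [||a1 a2] := @ann_complex _ _ _ mu2 theta mtheta X W1 W2 W1i W2i.
- by move=> _ [n ->]; exists (- n); rewrite rmorphN.
- move=> _ [n ->]; split.
    by have := re_mul n%:~R; rewrite /= Preal mul0r subr0 PQ0.
  by have := im_mul n%:~R; rewrite /= Preal Qreal mul0r mulr0 addr0.
have X1 y : X y -> X (y + 1) /\ X (y - 1).
  by move=> [n ->]; split; [exists (n + 1)|exists (n - 1)]; rewrite ?rmorphB ?rmorphD.
have X0 : X 0 by exists 0.
(* Both spectra vanish already at [|t| = B], which makes the phase strictly less than [pi] in
   modulus. *)
have thpi z : `|z.1| < B -> `|z.2| < B -> - pi < theta z < pi.
  move=> z1 z2; have : `|theta z| < pi.
    rewrite /theta normrM (gtr0_norm (_ : 0 < pi / (2 * B))); last first.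
      by rewrite divr_gt0 ?pi_gt0// mulr_gt0.
    rewrite mulrAC ltr_pdivrMr ?mulr_gt0// ltr_pM2l ?pi_gt0//.
    by rewrite (le_lt_trans (ler_normD _ _))//; lra.
  by rewrite ltr_norml.
have W1s z : W1 z != 0 -> - pi < theta z < pi.
  move=> Wz; apply: thpi; apply: contraR Wz; rewrite -leNgt.
    by move=> /Psupp[p1 p2]; rewrite /W1 p1 p2 !mul0r subrr.
  by move=> /Qsupp[q1 q2]; rewrite /W1 q1 q2 !mulr0 subrr.
have W2s z : W2 z != 0 -> - pi < theta z < pi.
  move=> Wz; apply: thpi; apply: contraR Wz; rewrite -leNgt.
    by move=> /Psupp[p1 p2]; rewrite /W2 p1 p2 !mul0r addr0.
  by move=> /Qsupp[q1 q2]; rewrite /W2 q1 q2 !mulr0 addr0.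
pose y := x / (pi / (2 * B)).
have xy : y * (pi / (2 * B)) = x.
  by rewrite /y divfK// gt_eqF// divr_gt0 ?pi_gt0// mulr_gt0.
have := re_mul y; rewrite /= xy Preal mul0r subr0 => <-.
rewrite RintegralB//; [|exact: rint_cosM|exact: rint_sinM].
have [-> _] := @ann_all _ _ R mu2 X theta mtheta X1 X0 W1 W1s a1 y.
by have [_ ->] := @ann_all _ _ R mu2 X theta mtheta X1 X0 W2 W2s a2 y; rewrite subrr.
Qed.

Lemma transform_mul_unique :
  {ae mu, forall t, P1 t = 0 /\ P2 t = 0} \/ {ae mu, forall t, Q1 t = 0 /\ Q2 t = 0}.
Proof.
have [P0|/existsNP[x0 /eqP Px0]] := pselect (forall x, reft P1 P2 x = 0).
  (* An identically zero transform permits any interval, here the one of radius 1 about 0. *)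
  left; apply: (@reft_unique_near R P1 P2 B 0 1) => // t tB.
  by apply: Psupp; exact: ltW.
right.
have := continuous_reft P1i P2i (x := x0).
move=> /cvgr_neq0 /(_ Px0) /nbhs_ballP[delta /= d0 H].
apply: (@reft_unique_near R Q1 Q2 B x0 delta) => // [t tB|x xd].
  by apply: Qsupp; exact: ltW.
split => //; apply/eqP; have /eqP := mul_transform_eq0 x.
rewrite mulf_eq0 => /orP[Px|//]; exfalso; move: Px; apply/negP.
by apply: H; rewrite /ball/= distrC.
Qed.

End ProductUniqueness.

(** * Bessel's inequality and square integrability *)

Section SquareIntegrable.
Variable R : realType.
Local Notation mu := (@lebesgue_measure R).

(** Domination through [2 |u w| <= u^2 + w^2]. *)
Lemma rint_mulL2 (u w : R -> R) : measurable_fun setT u -> measurable_fun setT w ->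
  rint mu (fun t => u t ^+ 2) -> rint mu (fun t => w t ^+ 2) ->
  rint mu (fun t => u t * w t).
Proof.
move=> mu_ mw u2 w2.
apply: (@rint_dom _ _ R mu (fun t => u t ^+ 2 + w t ^+ 2)); last exact: rintD.
  exact: measurable_funM.
move=> t; have h : 2 * (`|u t| * `|w t|) <= `|u t| ^+ 2 + `|w t| ^+ 2.
  by rewrite -subr_ge0; have := sqr_ge0 (`|u t| - `|w t|); rewrite sqrrB; lra.
rewrite normrM -[u t ^+ 2]real_normK ?num_real// -[w t ^+ 2]real_normK ?num_real//.
have := mulr_ge0 (normr_ge0 (u t)) (normr_ge0 (w t)); lra.
Qed.

Lemma rint_indic_itv (a b : R) : rint mu (fun t => \1_`[a, b] t).
Proof. exact: integrable_indic_itv. Qed.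

Lemma rint_bounded_support (u : R -> R) A : measurable_fun setT u ->
  rint mu (fun t => u t ^+ 2) -> (forall t, `|t| > A -> u t = 0) -> rint mu u.
Proof.
move=> mu_ u2 su.
have := rint_mulL2 (w := \1_`[- A, A]) mu_ _ u2 _.
move=> /(_ _ _)/eq_rint; apply => //.
- move=> t; rewrite indicE mem_setE in_itv/= -ler_norml.
  by case: leP => [|/su->]; rewrite ?mulr1 ?mul0r.
- apply: eq_rint (rint_indic_itv (- A) A) => t.
  by rewrite /= indicE; case: (_ \in _); rewrite ?expr1n ?expr0n.
Qed.

End SquareIntegrable.

Section Bessel.
Variables (R : realType) (B : R).
Hypothesis B0 : 0 < B.
Local Notation mu := (@lebesgue_measure R).
Local Notation reft := (reft mu id).

Lemma sin_mulrn_pi (k : nat) : sin (k%:R * pi) = 0 :> R.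
Proof.
elim: k => [|k ih]; first by rewrite mul0r sin0.
by rewrite -natr1 mulrDl mul1r sinD sinpi ih mulr0 mul0r addr0.
Qed.

Lemma Rint_cos_itv (c : R) : c != 0 ->
  (\int[mu]_(t in `[- B, B]) cos (c * t)) = 2 * sin (c * B) / c.
Proof.
move=> c0; have BB : - B < B by exact: gtrN.
have dF (t : R) : is_derive t (1 : R) (fun z : R => sin (c * z) / c) (cos (c * t)).
  have h : is_derive t (1 : R) (fun z : R => c * z) c.
    by apply: is_derive_eq; rewrite /= scaler1 // mulr1.
  have h2 := is_derive1_comp (f := @sin R) (g := fun z : R => c * z) (x := t).
  apply: is_derive_eq.
  by rewrite scaler0 add0r /GRing.scale/= mulrC mulfK.
rewrite /Rintegral (@continuous_FTC2 _ (fun t => cos (c * t)) (fun z : R => sin (c * z) / c))//=.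
- by rewrite mulrN sinN; field.
- apply: continuous_subspaceT => t.
  apply: (cvg_comp (fun z : R => c * z) (@cos R)); last exact: continuous_cos.
  by apply: cvgMl_tmp; exact: cvg_id.
- have cF (t : R) : {for t, continuous (fun z : R => sin (c * z) / c)}.
    by apply/differentiable_continuous/derivable1_diffP; have [] := dF t.
  split.
  + by move=> t _; have [] := dF t.
  + by apply: cvg_at_right_filter; exact: cF.
  + by apply: cvg_at_left_filter; exact: cF.
- by move=> t _; rewrite derive1E; have [] := dF t.
Qed.

Let D : set R := `[- B, B].

(** For [i != j] the integral is a multiple of [sin ((i - j) pi) = 0]; for [i = j] the integrand is
    1 on the band. *)
Lemma Rint_exp_orthogonal (i j : nat) (y : R) :
  (\int[mu]_t (\1_D t * cos ((y + i%:R * (pi / B) - (y + j%:R * (pi / B))) * t))) =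
  (i == j)%:R * (2 * B).
Proof.
have -> : y + i%:R * (pi / B) - (y + j%:R * (pi / B)) = (i%:R - j%:R) * (pi / B).
  by ring.
transitivity (\int[mu]_(t in D) cos ((i%:R - j%:R) * (pi / B) * t)).
  rewrite [RHS]Rintegral_mkcond; apply: eq_Rintegral => t _.
  by rewrite patchE indicE; case: ifPn => _; rewrite ?mul1r ?mul0r.
have [->|ij] := eqVneq i j.
  rewrite subrr mul0r; under eq_Rintegral do rewrite mul0r cos0.
  rewrite Rintegral_cst; last exact: measurable_itv.
  have mD : mu D = (2 * B)%:E.
    by rewrite [LHS]lebesgue_measure_itv/= lte_fin gtrN// -EFinB; congr EFin; ring.
  by rewrite [fine _](congr1 fine mD).
have pi0 := pi_gt0 R.
have c0 : (i%:R - j%:R) * (pi / B) != 0.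
  apply: mulf_neq0; first by rewrite subr_eq0 eqr_nat.
  by rewrite mulf_neq0 ?invr_neq0 ?gt_eqF.
rewrite Rint_cos_itv//.
have -> : (i%:R - j%:R) * (pi / B) * B = i%:R * pi - j%:R * pi.
  by field; rewrite gt_eqF.
by rewrite sinB !sin_mulrn_pi !(mul0r, mulr0) subrr mulr0 mul0r.
Qed.

Variables F1 F2 : R -> R.
Hypotheses (F1i : rint mu F1) (F2i : rint mu F2).
Hypotheses (F1sq : rint mu (fun t => F1 t ^+ 2)) (F2sq : rint mu (fun t => F2 t ^+ 2)).
Hypothesis Fsupp : forall t, `|t| > B -> F1 t = 0 /\ F2 t = 0.

Let E := \int[mu]_t (F1 t ^+ 2 + F2 t ^+ 2).

(* Duality: with [S = sum a_i exp(i z_i t)] one has [sum a_i^2 = Re (int F S)], and [int |S|^2]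
   over the band is [2 B sum a_i^2] because the frequencies [z_i] differ by multiples of [pi / B]. *)
Lemma bessel (N : nat) (y : R) :
  \sum_(i < N) reft F1 F2 (y + i%:R * (pi / B)) ^+ 2 <= 2 * B * E.
Proof.
pose z (i : 'I_N) := y + i%:R * (pi / B).
pose a (i : 'I_N) := reft F1 F2 (z i).
pose S1 t := \sum_(i < N) a i * cos (z i * t).
pose S2 t := \sum_(i < N) a i * sin (z i * t).
have AF i : rint mu (fun t => F1 t * cos (z i * t) - F2 t * sin (z i * t)).
  by apply: rintB; [exact: rint_cosR|exact: rint_sinR].
have e1 : \sum_i a i ^+ 2 = \int[mu]_t (F1 t * S1 t - F2 t * S2 t).
  transitivity (\int[mu]_t \sum_(i < N)
      (a i * (F1 t * cos (z i * t) - F2 t * sin (z i * t)))).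
    rewrite Rint_sum; last by move=> i; exact: rintZ.
    by apply: eq_bigr => i _; rewrite RintegralZl// expr2.
  apply: eq_Rintegral => t _; rewrite /S1 /S2 !mulr_sumr -sumrB.
  by apply: eq_bigr => i _; ring.
have i1 : rint mu (fun t => F1 t * S1 t - F2 t * S2 t).
  have := rint_sum (enum 'I_N) (fun i => rintZ (a i) (AF i)).
  apply: eq_rint => t; rewrite big_enum/= /S1 /S2 !mulr_sumr -sumrB.
  by apply: eq_bigr => i _; ring.
have Di i j : rint mu (fun t => a i * a j * (\1_D t * cos ((z i - z j) * t))).
  by apply: rintZ; apply: rint_cosR; exact: rint_indic_itv.
have sqE t : \1_D t * (S1 t ^+ 2 + S2 t ^+ 2) =
    \sum_(i < N) \sum_(j < N) a i * a j * (\1_D t * cos ((z i - z j) * t)).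
  rewrite /S1 /S2 !expr2 !big_distrlr/= -big_split/= mulr_sumr.
  apply: eq_bigr => i _; rewrite -big_split/= mulr_sumr.
  by apply: eq_bigr => j _; rewrite mulrBl cosB; ring.
have i2 : rint mu (fun t => \1_D t * (S1 t ^+ 2 + S2 t ^+ 2)).
  apply: (@eq_rint _ _ R mu _ _ (fun t => esym (sqE t))).
  by apply: rint_sum => i; exact: rint_sum.
have e2 : (\int[mu]_t (\1_D t * (S1 t ^+ 2 + S2 t ^+ 2))) = 2 * B * \sum_i a i ^+ 2.
  under eq_Rintegral do rewrite sqE.
  rewrite Rint_sum; last by move=> i; exact: rint_sum.
  rewrite mulr_sumr; apply: eq_bigr => i _.
  rewrite Rint_sum// (bigD1 i)//= big1 ?addr0.
    rewrite RintegralZl//; last by apply: rint_cosR; exact: rint_indic_itv.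
    by rewrite Rint_exp_orthogonal eqxx mul1r -expr2 mulrC.
  move=> j ji; rewrite RintegralZl//; last by apply: rint_cosR; exact: rint_indic_itv.
  by rewrite Rint_exp_orthogonal (_ : (_ == _) = false) ?mul0r ?mulr0//; apply/negbTE; rewrite eq_sym.
have Ei : rint mu (fun t => F1 t ^+ 2 + F2 t ^+ 2) by exact: rintD.
(* The pointwise bound [Re (F S) <= B |F|^2 + |S|^2 / (4B)] is a completed square; its last term
   integrates to half of the sum and is absorbed on the left. *)
have le : \sum_i a i ^+ 2 <= B * E + (4 * B)^-1 * (2 * B * \sum_i a i ^+ 2).
  rewrite [leLHS]e1 -e2 /E -RintegralZl// -RintegralZl// -RintegralD//; try exact: rintZ.
  apply: le_Rintegral => //; first by apply: rintD; exact: rintZ.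
  move=> t _; rewrite indicE mem_setE in_itv/= -ler_norml.
  have [tB|tB] := leP `|t| B; last first.
    by have [-> ->] := Fsupp tB; rewrite !mul0r expr0n/= subrr addr0 !mulr0 addr0.
  rewrite mul1r -subr_ge0.
  have -> : B * (F1 t ^+ 2 + F2 t ^+ 2) + (4 * B)^-1 * (S1 t ^+ 2 + S2 t ^+ 2) -
      (F1 t * S1 t - F2 t * S2 t) =
      (4 * B)^-1 * ((2 * B * F1 t - S1 t) ^+ 2 + (2 * B * F2 t + S2 t) ^+ 2).
    by field; rewrite gt_eqF.
  by rewrite mulr_ge0 ?addr_ge0 ?sqr_ge0// invr_ge0 mulr_ge0// ltW.
have h : (4 * B)^-1 * (2 * B * \sum_i a i ^+ 2) = (\sum_i a i ^+ 2) / 2.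
  by field; rewrite gt_eqF.
rewrite h in le; rewrite -[leLHS]/(\sum_i a i ^+ 2); lra.
Qed.

Let f (x : R) : R := reft F1 F2 (2 * pi * x).

Lemma continuous_bandlimited : continuous f.
Proof.
move=> x; apply: (cvg_comp (fun z : R => 2 * pi * z) (reft F1 F2)).
  by apply: cvgMl_tmp; exact: cvg_id.
exact: continuous_reft.
Qed.

Let h : R := (2 * B)^-1.
Let h0 : 0 < h. Proof. by rewrite invr_gt0 mulr_gt0. Qed.

Let mf2 : measurable_fun setT (fun x => f x ^+ 2).
Proof.
by apply: measurable_funX; apply: continuous_measurable_fun; exact: continuous_bandlimited.
Qed.

(** Cell [i] starts at [(i - N) h]; being half-open, the first [2N] cells tile the window [[- N h, N
    h[]. *)
Let cell (N i : nat) (t : R) : bool := 0 <= t + N%:R * h - i%:R * h < h.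

Let mcell N i : measurable_fun setT (fun t => (cell N i t)%:R : R).
Proof.
rewrite (_ : (fun _ => _) = \1_`[i%:R * h - N%:R * h, i%:R * h - N%:R * h + h[).
  exact: measurable_indic.
apply/funext => t; rewrite indicE mem_setE in_itv/= /cell.
suff -> : (0 <= t + N%:R * h - i%:R * h < h) =
  (i%:R * h - N%:R * h <= t < i%:R * h - N%:R * h + h) by [].
by congr andb; apply/idP/idP => ?; lra.
Qed.

(* The window is cut into cells of length [h = 1 / (2 B)]; translating all cells to [0, h[ turns
   the sampled Bessel inequality into a bound on the integral. *)
Lemma bandlimited_window (N : nat) :
  (\int[mu]_t ((- (N%:R * h) <= t < N%:R * h)%R%:R * f t ^+ 2)%:E <= E%:E)%E.
Proof.
pose g i t := ((cell N i t)%:R * f t ^+ 2)%:E.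
have mg i : measurable_fun setT (g i).
  by apply/measurable_EFinP; exact: (measurable_funM (mcell N i) mf2).
have g0 i t : (0 <= g i t)%E by rewrite lee_fin mulr_ge0 ?sqr_ge0.
apply: (@le_trans _ _ (\int[mu]_t \sum_(i < N + N) g i t)%E).
  apply: ge0_le_integral => //.
  - by move=> t _; rewrite lee_fin mulr_ge0 ?sqr_ge0.
  - apply/measurable_EFinP; apply: measurable_funM => //.
    rewrite (_ : (fun _ => _) = \1_`[- (N%:R * h), N%:R * h[); first exact: measurable_indic.
    by apply/funext => t; rewrite indicE mem_setE in_itv.
  - by apply: emeasurable_sum => i; exact: mg.
  - move=> t _; case: (boolP (- (N%:R * h) <= t < N%:R * h)) => [/andP[t1 t2]|_]; last by rewrite mul0r; apply: sume_ge0.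
    have r0 : 0 <= (t + N%:R * h) / h by apply: divr_ge0; [lra|exact: ltW].
    (* The index of the cell that contains [t]. *)
    pose k := Num.truncn ((t + N%:R * h) / h).
    have /andP[k1 k2] := truncn_itv r0.
    have kN : (k < N + N)%N.
      rewrite -(ltr_nat R) natrD (le_lt_trans k1)// ltr_pdivrMr// mulrDl; lra.
    apply: (@le_trans _ _ (g k t)); last first.
      by rewrite (bigD1 (Ordinal kN))//= leeDl//; exact: sume_ge0.
    rewrite /g lee_fin ler_wpM2r ?sqr_ge0// /cell /= (_ : _ && _)//.
    move: k1 k2; rewrite -/k ler_pdivlMr// ltr_pdivrMr// -natr1 mulrDl mul1r => k1 k2.
    by apply/andP; split; lra.
rewrite ge0_integral_sum//; last by move=> i; exact: mg.
pose G i s := ((0 <= s < h)%R%:R * f (s + (i%:R * h - N%:R * h)) ^+ 2).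
have mind : measurable_fun setT (fun s : R => (0 <= s < h)%R%:R : R).
  rewrite (_ : (fun _ => _) = \1_`[0, h[); first exact: measurable_indic.
  by apply/funext => t; rewrite indicE mem_setE in_itv.
have mG i : measurable_fun setT (fun s => (G i s)%:E).
  apply/measurable_EFinP; apply: measurable_funM => //.
  by apply: (measurableT_comp mf2); exact: measurable_shift.
have G0 i s : (0 <= (G i s)%:E)%E by rewrite lee_fin mulr_ge0 ?sqr_ge0.
rewrite (eq_bigr (fun i : 'I_(N + N) => \int[mu]_s (G i s)%:E)%E); last first.
  move=> i _; rewrite -[LHS](@ge0_integral_shift R (i%:R * h - N%:R * h))//.
  apply: eq_integral => s _; rewrite /g /G /cell; congr ((_%:R * _)%:E).
  by have -> : s + (i%:R * h - N%:R * h) + N%:R * h - i%:R * h = s by ring.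
rewrite -ge0_integral_sum//; last by move=> i; exact: mG.
apply: (@le_trans _ _ (\int[mu]_s ((0 <= s < h)%R%:R * (2 * B * E))%:E)%E).
  apply: ge0_le_integral => //.
  - by move=> s _; exact: sume_ge0.
  - by apply: emeasurable_sum => i; exact: mG.
  - by apply/measurable_EFinP; exact: measurable_funM.
  - move=> s _; rewrite sumEFin lee_fin -mulr_sumr ler_wpM2l//.
    (* As [h = 1 / (2B)], the points [s + (i - N) h] have angular frequencies in steps of
       [2 pi h = pi / B], starting from [2 pi (s - N h)]. *)
    have := bessel (N + N) (2 * pi * (s - N%:R * h)); apply: le_trans.
    apply: ler_sum => i _; rewrite /f le_eqVlt; apply/orP; left; apply/eqP.
    by congr (reft F1 F2 _ ^+ 2); rewrite /h; field; rewrite gt_eqF.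
have E0 : 0 <= E by apply: Rintegral_ge0 => t _; rewrite addr_ge0 ?sqr_ge0.
have -> : (\int[mu]_s ((0 <= s < h)%R%:R * (2 * B * E))%:E =
    \int[mu]_s ((2 * B * E)%:E * (\1_`[0%R, h[ s)%:E))%E.
  by apply: eq_integral => s _; rewrite -EFinM indicE mem_setE in_itv/= mulrC.
rewrite ge0_integralZl//; last 2 first.
  by apply/measurable_EFinP; exact: measurable_indic.
  by rewrite lee_fin !mulr_ge0// ltW.
rewrite integral_indic// setIT.
have mh : mu `[0, h[ = h%:E by rewrite [LHS]lebesgue_measure_itv/= lte_fin h0 sube0.
suff : ((2 * B * E)%:E * h%:E <= E%:E)%E by rewrite -mh.
rewrite -EFinM lee_fin.
by rewrite /h le_eqVlt; apply/orP; left; apply/eqP; field; rewrite gt_eqF.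
Qed.

(** Monotone convergence along the growing windows, whose integrals are bounded by [E] independently
    of [N]. *)
Lemma rint_sqr_bandlimited : rint mu (fun x => f x ^+ 2).
Proof.
pose g N t := ((- (N%:R * h) <= t < N%:R * h)%R%:R * f t ^+ 2)%:E.
have mg N : measurable_fun setT (g N).
  apply/measurable_EFinP; apply: measurable_funM => //.
  rewrite (_ : (fun _ => _) = \1_`[- (N%:R * h), N%:R * h[); first exact: measurable_indic.
  by apply/funext => t; rewrite indicE mem_setE in_itv.
have g0 N t : (0 <= g N t)%E by rewrite lee_fin mulr_ge0 ?sqr_ge0.
apply/integrableP; split; first exact/measurable_EFinP.
have gh t : {homo (fun n => g n t) : n m / (n <= m)%N >-> (n <= m)%E}.
  move=> n m nm; rewrite lee_fin ler_wpM2r ?sqr_ge0// ler_nat.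
  have nmh : n%:R * h <= m%:R * h by rewrite ler_wpM2r ?ler_nat// ltW.
  case: (boolP (- (n%:R * h) <= t < _)) => // /andP[t1 t2].
  by rewrite (_ : _ && _)//; apply/andP; split; lra.
have := @monotone_convergence _ _ R mu setT measurableT g mg (fun n t _ => g0 n t) (fun t _ => gh t).
have e : (\int[mu]_x (f x ^+ 2)%:E = \int[mu]_x limn (g^~ x))%E.
  apply: eq_integral => t _; apply/esym/cvg_lim => //; apply: cvg_near_cst.
  exists (Num.truncn (`|t| / h)).+1 => // n /= tn.
  have : `|t| / h < n%:R.
    by rewrite (lt_le_trans (truncnS_gt _))// ler_nat.
  rewrite ltr_pdivrMr// ltr_norml => /andP[t1 t2].
  by rewrite /g (_ : _ && _) ?mul1r//; apply/andP; split; [exact: ltW|].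
rewrite -e => e'.
under eq_integral do rewrite /= ger0_norm ?sqr_ge0//.
move: e'; move=> ->; apply: le_lt_trans (ltry E); apply: lime_le.
  apply: ereal_nondecreasing_is_cvgn => n m nm.
  by apply: ge0_le_integral => //; do ?[exact: mg]; move=> t _; exact: gh.
by apply: nearW => n; exact: bandlimited_window.
Qed.

End Bessel.

(** * Parseval's identity for band-limited functions *)

Section Parseval.
Variables (R : realType) (B : R).
Hypothesis B0 : 0 < B.
Local Notation mu := (@lebesgue_measure R).
Local Notation reft := (reft mu id).
Variables F1 F2 : R -> R.
Hypotheses (F1i : rint mu F1) (F2i : rint mu F2).
Hypotheses (F1sq : rint mu (fun t => F1 t ^+ 2)) (F2sq : rint mu (fun t => F2 t ^+ 2)).
Hypothesis Fsupp : forall t, `|t| > B -> F1 t = 0 /\ F2 t = 0.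

Let f (x : R) : R := reft F1 F2 (2 * pi * x).

(** The frequency [xi] carries the factor [2 pi], while that of [reft] is angular. *)
Definition cosft (v : R -> R) (xi : R) : R := \int[mu]_t (v t * cos (2 * pi * xi * t)).
Definition sinft (v : R -> R) (xi : R) : R := \int[mu]_t (v t * sin (2 * pi * xi * t)).

Let continuous_dilation (g : R -> R) : continuous g -> continuous (fun x : R => g (2 * pi * x)).
Proof.
move=> cg x; apply: (cvg_comp (fun z : R => 2 * pi * z) g); last exact: cg.
by apply: cvgMl_tmp; exact: cvg_id.
Qed.

Lemma measurable_cosft v : rint mu v -> measurable_fun setT (cosft v).
Proof.
move=> vi; apply: continuous_measurable_fun.
apply: (continuous_dilation (g := fun x : R => \int[mu]_t (v t * cos (x * t)))).
by apply: (continuous_transform vi) => [|y]; [exact: continuous_cos|exact: cos_norm].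
Qed.

Lemma measurable_sinft v : rint mu v -> measurable_fun setT (sinft v).
Proof.
move=> vi; apply: continuous_measurable_fun.
apply: (continuous_dilation (g := fun x : R => \int[mu]_t (v t * sin (x * t)))).
by apply: (continuous_transform vi) => [|y]; [exact: continuous_sin|exact: sin_norm].
Qed.

Lemma Rint_mul_norm (v k : R -> R) : rint mu v -> measurable_fun setT k ->
  (forall t, `|k t| <= 1) -> `|\int[mu]_t (v t * k t)| <= \int[mu]_t `|v t|.
Proof.
move=> vi mk k1; have vk := rint_bmulR mk k1 vi.
apply: (le_trans (le_normr_Rintegral measurableT vk)).
apply: le_Rintegral => //; [exact: integrable_norm|exact: integrable_norm|].
by move=> t _; rewrite normrM ler_piMr.
Qed.

Let mcosR x : measurable_fun setT (fun t : R => cos (x * t)).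
Proof. exact: (@measurable_cosM _ R R id (@measurable_id _ _ _)). Qed.

Let msinR x : measurable_fun setT (fun t : R => sin (x * t)).
Proof. exact: (@measurable_sinM _ R R id (@measurable_id _ _ _)). Qed.

Lemma cosft_norm v xi : rint mu v -> `|cosft v xi| <= \int[mu]_t `|v t|.
Proof. by move=> vi; apply: Rint_mul_norm => // t; exact: cos_norm. Qed.

Lemma sinft_norm v xi : rint mu v -> `|sinft v xi| <= \int[mu]_t `|v t|.
Proof. by move=> vi; apply: Rint_mul_norm => // t; exact: sin_norm. Qed.

Let Rint_shift_mul (v k : R -> R) x : rint mu v -> measurable_fun setT k ->
  (forall t, `|k t| <= 1) ->
  (\int[mu]_t (v (t - x) * k t)) = \int[mu]_t (v t * k (t + x)).
Proof.
move=> vi mk k1.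
have mk' : measurable_fun setT (fun t : R => k (t + x)).
  by apply: (measurableT_comp mk); exact: measurable_shift.
rewrite -[RHS](Rint_shift (- x)); last exact: (rint_bmulR mk' (fun t => k1 _)).
by apply: eq_Rintegral => t _; rewrite subrK.
Qed.

Lemma cosft_shift v x xi : rint mu v ->
  (\int[mu]_t (v (t - x) * cos (2 * pi * xi * t))) =
  cosft v xi * cos (2 * pi * x * xi) - sinft v xi * sin (2 * pi * x * xi).
Proof.
move=> vi; rewrite (Rint_shift_mul (k := fun t => cos (2 * pi * xi * t)))//; last first.
  by move=> t; exact: cos_norm.
have ci := rint_cosR (2 * pi * xi) vi; have si := rint_sinR (2 * pi * xi) vi.
rewrite /cosft /sinft -!RintegralZr// -RintegralB//; last 2 first.
- by apply: eq_rint (rintZ (cos (2 * pi * x * xi)) ci) => t; rewrite mulrC.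
- by apply: eq_rint (rintZ (sin (2 * pi * x * xi)) si) => t; rewrite mulrC.
apply: eq_Rintegral => t _; rewrite mulrDr cosD.
by rewrite (_ : 2 * pi * xi * x = 2 * pi * x * xi); ring.
Qed.

Lemma sinft_shift v x xi : rint mu v ->
  (\int[mu]_t (v (t - x) * sin (2 * pi * xi * t))) =
  sinft v xi * cos (2 * pi * x * xi) + cosft v xi * sin (2 * pi * x * xi).
Proof.
move=> vi; rewrite (Rint_shift_mul (k := fun t => sin (2 * pi * xi * t)))//; last first.
  by move=> t; exact: sin_norm.
have ci := rint_cosR (2 * pi * xi) vi; have si := rint_sinR (2 * pi * xi) vi.
rewrite /cosft /sinft -!RintegralZr// -RintegralD//; last 2 first.
- by apply: eq_rint (rintZ (cos (2 * pi * x * xi)) si) => t; rewrite mulrC.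
- by apply: eq_rint (rintZ (sin (2 * pi * x * xi)) ci) => t; rewrite mulrC.
apply: eq_Rintegral => t _; rewrite mulrDr sinD.
by rewrite (_ : 2 * pi * xi * x = 2 * pi * x * xi); ring.
Qed.

(** For integrable [v], Parseval is Fubini alone: [f] is written out by its spectrum, the integrals
    are exchanged, and the translation by [x] becomes a modulation. *)
Lemma Rint_bandlimited_mul v x : rint mu v ->
  (\int[mu]_t (f t * v (t - x))) =
  reft (fun xi => F1 xi * cosft v xi - F2 xi * sinft v xi)
       (fun xi => F1 xi * sinft v xi + F2 xi * cosft v xi) (2 * pi * x).
Proof.
move=> vi; have wi : rint mu (fun t => v (t - x)) := rint_shift (- x) vi.
have mk : measurable_fun setT (fun z : R * R => 2 * pi * z.1 * z.2).
  apply: measurable_funM; last exact: measurable_snd.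
  by apply: measurable_funM => //; exact: measurable_fst.
have mkc : measurable_fun setT (fun z : R * R => cos (2 * pi * z.1 * z.2)).
  apply: (measurableT_comp (f := @cos R)) => //.
  by apply: continuous_measurable_fun; exact: continuous_cos.
have mks : measurable_fun setT (fun z : R * R => sin (2 * pi * z.1 * z.2)).
  apply: (measurableT_comp (f := @sin R)) => //.
  by apply: continuous_measurable_fun; exact: continuous_sin.
have swap1 := Rint_swap_kernel F1i wi mkc (fun z => cos_norm _).
have swap2 := Rint_swap_kernel F2i wi mks (fun z => sin_norm _).
have fE t : f t = cosft F1 t - sinft F2 t by rewrite /f reftE.
have i1 : rint mu (fun t => cosft F1 t * v (t - x)).
  apply: eq_rint (rint_bmulR (measurable_cosft F1i) (fun t => cosft_norm _ F1i) wi).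
  by move=> t; rewrite mulrC.
have i2 : rint mu (fun t => sinft F2 t * v (t - x)).
  apply: eq_rint (rint_bmulR (measurable_sinft F2i) (fun t => sinft_norm _ F2i) wi).
  by move=> t; rewrite mulrC.
under eq_Rintegral do rewrite fE mulrBl.
rewrite RintegralB//.
have e1 : (\int[mu]_t (cosft F1 t * v (t - x))) = \int[mu]_s (F1 s *
    (cosft v s * cos (2 * pi * x * s) - sinft v s * sin (2 * pi * x * s))).
  transitivity (\int[mu]_t ((\int[mu]_s (F1 s * cos (2 * pi * s * t))) * v (t - x))).
    apply: eq_Rintegral => t _; congr (_ * _); apply: eq_Rintegral => s _.
    by congr (_ * cos _); ring.
  by rewrite swap1; apply: eq_Rintegral => s _; rewrite /= cosft_shift.
have e2 : (\int[mu]_t (sinft F2 t * v (t - x))) = \int[mu]_s (F2 s *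
    (sinft v s * cos (2 * pi * x * s) + cosft v s * sin (2 * pi * x * s))).
  transitivity (\int[mu]_t ((\int[mu]_s (F2 s * sin (2 * pi * s * t))) * v (t - x))).
    apply: eq_Rintegral => t _; congr (_ * _); apply: eq_Rintegral => s _.
    by congr (_ * sin _); ring.
  by rewrite swap2; apply: eq_Rintegral => s _; rewrite /= sinft_shift.
have Fc u : rint mu u -> rint mu (fun xi => u xi * cosft v xi).
  by move=> ui; exact: (rint_bmulR (measurable_cosft vi) (fun t => cosft_norm _ vi) ui).
have Fs u : rint mu u -> rint mu (fun xi => u xi * sinft v xi).
  by move=> ui; exact: (rint_bmulR (measurable_sinft vi) (fun t => sinft_norm _ vi) ui).
rewrite e1 e2 -RintegralB//.
- by apply: eq_Rintegral => s _ /=; ring.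
- have := rintB (rint_cosR (2 * pi * x) (Fc _ F1i)) (rint_sinR (2 * pi * x) (Fs _ F1i)).
  by apply: eq_rint => s; ring.
- have := rintD (rint_cosR (2 * pi * x) (Fs _ F2i)) (rint_sinR (2 * pi * x) (Fc _ F2i)).
  by apply: eq_rint => s; ring.
Qed.

Variables phi c e : R -> R.
Hypotheses (mphi : measurable_fun setT phi) (phisq : rint mu (fun t => phi t ^+ 2)).
Hypotheses (mc : measurable_fun setT c) (csq : rint mu (fun t => c t ^+ 2)).
Hypotheses (me : measurable_fun setT e) (esq : rint mu (fun t => e t ^+ 2)).

(** Truncations of the square integrable window are integrable as well, hence admissible for
    approximating its Fourier transform. *)
Definition trunc_itv (n : nat) (t : R) : R := phi t * \1_`[- n%:R, n%:R] t.

Lemma trunc_itv_int n : rint mu (trunc_itv n).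
Proof.
apply: rint_mulL2 => //.
apply: eq_rint (rint_indic_itv (- n%:R) n%:R) => t.
by rewrite /= indicE; case: (_ \in _); rewrite ?expr1n ?expr0n.
Qed.

Lemma trunc_itv_norm n t : `|trunc_itv n t| <= `|phi t|.
Proof. by rewrite /trunc_itv indicE normrM; case: (_ \in _); rewrite ?normr1 ?mulr1 ?normr0 ?mulr0. Qed.

Lemma near_trunc_itv t : \forall n \near \oo, trunc_itv n t = phi t.
Proof.
exists (Num.truncn `|t|).+1 => // n /= tn.
have : `|t| < n%:R by rewrite (lt_le_trans (truncnS_gt _))// ler_nat.
rewrite ltr_norml => /andP[t1 t2]; rewrite /trunc_itv indicE mem_setE in_itv/=.
by rewrite !ltW// mulr1.
Qed.

(* The Fourier transform of the truncated window is [cosft - i sinft], that of [phi] is [c + i e]. *)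
Hypothesis lim : (\int[mu]_t ((cosft (trunc_itv n) t - c t) ^+ 2 +
  (sinft (trunc_itv n) t + e t) ^+ 2)%:E)%E @[n --> \oo] --> 0%E.

Let E := \int[mu]_t (F1 t ^+ 2 + F2 t ^+ 2).

(** Cauchy-Schwarz in the form [|F d| <= a |F|^2 / 2 + |d|^2 / (2a)], with [d] the error of the
    transform of the truncated window. *)
Lemma reft_limit x :
  reft (fun xi => F1 xi * cosft (trunc_itv n) xi - F2 xi * sinft (trunc_itv n) xi)
       (fun xi => F1 xi * sinft (trunc_itv n) xi + F2 xi * cosft (trunc_itv n) xi) x
  @[n --> \oo] -->
  reft (fun xi => F1 xi * c xi + F2 xi * e xi) (fun xi => F2 xi * c xi - F1 xi * e xi) x.
Proof.
have mF1 := rint_measurable F1i; have mF2 := rint_measurable F2i.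
have E0 : 0 <= E by apply: Rintegral_ge0 => t _; rewrite addr_ge0 ?sqr_ge0.
have Ei : rint mu (fun t => F1 t ^+ 2 + F2 t ^+ 2) by exact: rintD.
have P1i : rint mu (fun xi => F1 xi * c xi + F2 xi * e xi) by apply: rintD; exact: rint_mulL2.
have P2i : rint mu (fun xi => F2 xi * c xi - F1 xi * e xi) by apply: rintB; exact: rint_mulL2.
apply/cvgrPdistC_le => eps eps0.
(* With this [a] the first term integrates to at most [eps / 2], and a squared error of at most
   [a eps] does the same for the second; [E + 1] avoids dividing by 0. *)
pose a := eps / (E + 1).
have E1 : 0 < E + 1 by lra.
have a0 : 0 < a by rewrite divr_gt0.
have ae0 : 0 < a * eps by rewrite mulr_gt0.
have /fine_cvgP[finn /cvgrPdistC_le /(_ _ ae0)] := lim.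
apply: filterS2 finn => n /= finn; rewrite subr0.
set dc := fun t => cosft (trunc_itv n) t - c t.
set de := fun t => sinft (trunc_itv n) t + e t.
have vi := trunc_itv_int n.
have mdc : measurable_fun setT dc by apply: measurable_funB => //; exact: measurable_cosft.
have mde : measurable_fun setT de by apply: measurable_funD => //; exact: measurable_sinft.
have mDd : measurable_fun setT (fun t => dc t ^+ 2 + de t ^+ 2).
  by apply: measurable_funD; exact: measurable_funX.
have Di : rint mu (fun t => dc t ^+ 2 + de t ^+ 2).
  apply/integrableP; split; first exact/measurable_EFinP.
  under eq_integral do rewrite /= ger0_norm ?addr_ge0 ?sqr_ge0//.
  by rewrite ltey_eq finn.
set del := fine _ => hdel.
have del0 : del = \int[mu]_t (dc t ^+ 2 + de t ^+ 2) by [].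
have Fc u : rint mu u -> rint mu (fun xi => u xi * cosft (trunc_itv n) xi).
  by move=> ui; exact: (rint_bmulR (measurable_cosft vi) (fun t => cosft_norm _ vi) ui).
have Fs u : rint mu u -> rint mu (fun xi => u xi * sinft (trunc_itv n) xi).
  by move=> ui; exact: (rint_bmulR (measurable_sinft vi) (fun t => sinft_norm _ vi) ui).
have Q1i : rint mu (fun xi => F1 xi * cosft (trunc_itv n) xi - F2 xi * sinft (trunc_itv n) xi).
  by apply: rintB; [exact: Fc|exact: Fs].
have Q2i : rint mu (fun xi => F1 xi * sinft (trunc_itv n) xi + F2 xi * cosft (trunc_itv n) xi).
  by apply: rintD; [exact: Fs|exact: Fc].
have Ri u w : rint mu u -> rint mu w -> rint mu (fun t => u t * cos (x * t) - w t * sin (x * t)).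
  by move=> ui wi; apply: rintB; [exact: rint_cosR|exact: rint_sinR].
rewrite /reft -RintegralB//; try exact: Ri.
apply: (le_trans (le_normr_Rintegral measurableT (rintB (Ri _ _ Q1i Q2i) (Ri _ _ P1i P2i)))).
apply: (@le_trans _ _ (\int[mu]_t (a / 2 * (F1 t ^+ 2 + F2 t ^+ 2) +
    (2 * a)^-1 * (dc t ^+ 2 + de t ^+ 2)))).
  apply: le_Rintegral => //.
  - exact: integrable_norm (rintB (Ri _ _ Q1i Q2i) (Ri _ _ P1i P2i)).
  - by apply: rintD; exact: rintZ.
  - move=> t _.
    set C := cos (x * t); set S := sin (x * t).
    have CS : C ^+ 2 + S ^+ 2 = 1 by exact: cos2Dsin2.
    (* The error rotated by the angle [x t] and conjugated: its modulus is unchanged. *)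
    pose u := dc t * C - de t * S; pose w := - (dc t * S + de t * C).
    have uw : dc t ^+ 2 + de t ^+ 2 = u ^+ 2 + w ^+ 2.
      by rewrite -[LHS]mulr1 -CS /u /w; ring.
    rewrite (_ : _ - _ = F1 t * u + F2 t * w); last by rewrite /u /w /dc /de /=; ring.
    rewrite uw ler_norml -subr_ge0 -[X in _ && X]subr_ge0; apply/andP; split.
      rewrite (_ : _ - _ = (2 * a)^-1 * ((a * F1 t + u) ^+ 2 + (a * F2 t + w) ^+ 2)).
        by rewrite mulr_ge0 ?addr_ge0 ?sqr_ge0// invr_ge0 mulr_ge0// ltW.
      by field; rewrite gt_eqF.
    rewrite (_ : _ - _ = (2 * a)^-1 * ((a * F1 t - u) ^+ 2 + (a * F2 t - w) ^+ 2)).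
      by rewrite mulr_ge0 ?addr_ge0 ?sqr_ge0// invr_ge0 mulr_ge0// ltW.
    by field; rewrite gt_eqF.
rewrite RintegralD//; try exact: rintZ.
rewrite !RintegralZl// -/E -del0.
have h1 : a / 2 * E <= eps / 2.
  have aE : a * (E + 1) = eps by rewrite /a divfK// gt_eqF.
  by rewrite -aE; lra.
have h2 : (2 * a)^-1 * del <= eps / 2.
  have a20 : 0 < 2 * a by exact: mulr_gt0.
  rewrite mulrC ler_pdivrMr//.
  have -> : eps / 2 * (2 * a) = a * eps by field.
  exact: le_trans (ler_norm _) hdel.
by rewrite [eps]splitr; exact: lerD.
Qed.

(** The left side converges along truncations by domination, [f] being square integrable like the
    window; the right side converges by [reft_limit]. With [Phi = c + i e] the limit has spectrum
    [F conj Phi]. *)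
Lemma parseval x : rint mu (fun t => f t * phi (t - x)) /\
  (\int[mu]_t (f t * phi (t - x))) =
  reft (fun xi => F1 xi * c xi + F2 xi * e xi) (fun xi => F2 xi * c xi - F1 xi * e xi)
    (2 * pi * x).
Proof.
have fsq : rint mu (fun t => f t ^+ 2) by exact: (@rint_sqr_bandlimited R B).
have mf : measurable_fun setT f.
  by apply: continuous_measurable_fun; exact: continuous_bandlimited.
have phixsq : rint mu (fun t => phi (t - x) ^+ 2) := rint_shift (- x) phisq.
have mphix : measurable_fun setT (fun t : R => phi (t - x)).
  by apply: (measurableT_comp mphi); exact: measurable_shift.
have fphi := rint_mulL2 mf mphix fsq phixsq.
split => //.
have [|||_] := @Rint_dominated _ _ R mu (fun n t => f t * trunc_itv n (t - x))
  (fun t => f t * phi (t - x)) (fun t => `|f t * phi (t - x)|) _ (integrable_norm fphi).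
- move=> n; apply: measurable_funM => //.
  by apply: rint_measurable; exact: (rint_shift (- x) (trunc_itv_int n)).
- by move=> n t; rewrite [leLHS]normrM [leRHS]normrM; apply: ler_wpM2l => //; exact: (trunc_itv_norm n (t - x)).
- move=> t; apply: cvgMl_tmp; apply: cvg_near_cst; exact: near_trunc_itv.
move=> h1; have h2 := reft_limit (x := 2 * pi * x).
have h3 : (\int[mu]_t (f t * trunc_itv n (t - x))) @[n --> \oo] --> 
  reft (fun xi => F1 xi * c xi + F2 xi * e xi) (fun xi => F2 xi * c xi - F1 xi * e xi)
    (2 * pi * x).
  under eq_cvg do rewrite (Rint_bandlimited_mul _ (trunc_itv_int _)).
  exact: h2.
exact: (cvg_unique _ h1 h3).
Qed.

End Parseval.

(** * Spectra of Paley-Wiener functions and of the window *)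

Section ComplexBridge.
Variable R : realType.
Local Notation mu := (@lebesgue_measure R).
Local Notation C := (R[i]).
Local Notation re := (@complex.Re R).
Local Notation im := (@complex.Im R).

Lemma cabs_sqr (z : C) : cabs z ^+ 2 = re z ^+ 2 + im z ^+ 2.
Proof. by rewrite /cabs sqr_sqrtr// addr_ge0 ?sqr_ge0. Qed.

Lemma cabs_real (a : R) : cabs (Complex a 0) = `|a|.
Proof. by rewrite /cabs /= expr0n addr0 sqrtr_sqr. Qed.

Lemma cL2_component (D : set R) (h : R -> C) (p : C -> R) : measurable D ->
  measurable_fun D (fun t => p (h t)) -> (forall z, p z ^+ 2 <= cabs z ^+ 2) ->
  (\int[mu]_(t in D) ((cabs (h t)) ^+ 2)%:E < +oo)%E ->
  measurable_fun D (fun t => cabs (h t)) ->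
  measurable_fun setT ((fun t => p (h t)) \_ D) /\
  rint mu (fun t => ((fun t => p (h t)) \_ D) t ^+ 2).
Proof.
move=> mD mp pc fin mcabs.
have m1 : measurable_fun setT ((fun t => p (h t)) \_ D) by apply/(measurable_restrictT _ mD).
have m2 : measurable_fun setT (fun t => ((fun t => p (h t)) \_ D) t ^+ 2).
  exact: measurable_funX.
split => //; apply/integrableP; split; first exact/measurable_EFinP.
move: fin; rewrite integral_mkcond; apply: le_lt_trans.
apply: ge0_le_integral => //.
- by apply/measurable_EFinP; exact: measurableT_comp.
- apply/(measurable_restrictT _ mD)/measurable_EFinP; exact: measurable_funX.
- move=> t _; rewrite /= !patchE; case: ifPn => _; last by rewrite expr0n/= normr0.
  by rewrite lee_fin ger0_norm ?sqr_ge0.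
Qed.

Lemma measurable_cabs (D : set R) (h : R -> C) : measurable D -> cmeasurable D h ->
  measurable_fun D (fun t => cabs (h t)).
Proof.
move=> mD [m1 m2]; apply: (measurableT_comp (f := @Num.sqrt R)).
  by apply: continuous_measurable_fun; exact: sqrt_continuous.
by apply: measurable_funD; exact: measurable_funX.
Qed.

Lemma cL2_parts (D : set R) (h : R -> C) : measurable D -> cL2 D h ->
  let h1 := (fun t => re (h t)) \_ D in let h2 := (fun t => im (h t)) \_ D in
  [/\ measurable_fun setT h1, measurable_fun setT h2,
      rint mu (fun t => h1 t ^+ 2) & rint mu (fun t => h2 t ^+ 2)].
Proof.
move=> mD [mh fin] h1 h2; have mcabs := measurable_cabs mD mh; have [mre mim] := mh.
have [] := cL2_component (p := re) mD mre _ fin mcabs.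
  by move=> z; rewrite cabs_sqr lerDl sqr_ge0.
have [] := cL2_component (p := im) mD mim _ fin mcabs.
  by move=> z; rewrite cabs_sqr lerDr sqr_ge0.
by [].
Qed.

(** Endpoints are null sets; passing to the open band gives spectra that vanish at [|t| = B] as
    well. *)
Lemma Rint_itvcc_itvoo (u : R -> R) B : mu.-integrable `[- B, B] (EFin \o u) ->
  (\int[mu]_(t in `[- B, B]) u t) = \int[mu]_t (u \_ `]- B, B[) t.
Proof.
move=> ui; rewrite -Rintegral_mkcond.
have io : mu.-integrable `]- B, B[ (EFin \o u).
  by apply: integrableS ui => //; apply: subset_itv; rewrite bnd_simp.
have ico : mu.-integrable `[- B, B[ (EFin \o u).
  by apply: integrableS ui => //; apply: subset_itv; rewrite bnd_simp.
by rewrite -Rintegral_itv_bndo_bndc// -Rintegral_itv_obnd_cbnd.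
Qed.

Lemma Rint_ae_eq (u w : R -> R) : measurable_fun setT u -> measurable_fun setT w ->
  {ae mu, forall t, u t = w t} -> (\int[mu]_t u t) = \int[mu]_t w t.
Proof.
move=> mu_ mw uw; rewrite /Rintegral; congr fine; apply: ae_eq_integral => //.
- exact/measurable_EFinP.
- exact/measurable_EFinP.
- move: uw; apply: filterS; first exact: (ae_filter_ringOfSetsType mu).
  by move=> t /= ->.
Qed.

(* Real and imaginary part of [exp(2 i pi xi z)]. *)
Definition kre (z : C) (xi : R) : R := expR (- (2 * pi * xi * im z)) * cos (2 * pi * re z * xi).
Definition kim (z : C) (xi : R) : R := expR (- (2 * pi * xi * im z)) * sin (2 * pi * re z * xi).

Lemma measurable_exp_damping (z : C) :
  measurable_fun setT (fun xi : R => expR (- (2 * pi * xi * im z))).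
Proof.
apply: (measurableT_comp (f := @expR R)).
  by apply: continuous_measurable_fun; exact: continuous_expR.
by apply: measurableT_comp => //; apply: measurable_funM => //; exact: measurable_funM.
Qed.

Lemma measurable_kre z : measurable_fun setT (kre z).
Proof.
apply: measurable_funM; first exact: measurable_exp_damping.
exact: (@measurable_cosM _ R R id (@measurable_id _ _ _)).
Qed.

Lemma measurable_kim z : measurable_fun setT (kim z).
Proof.
apply: measurable_funM; first exact: measurable_exp_damping.
exact: (@measurable_sinM _ R R id (@measurable_id _ _ _)).
Qed.

Lemma damping_bound z B xi (k : R) : `|xi| <= B -> `|k| <= 1 ->
  `|expR (- (2 * pi * xi * im z)) * k| <= expR (2 * pi * B * `|im z|).
Proof.
move=> xB k1; rewrite normrM ger0_norm ?expR_ge0// (le_trans (ler_piMr _ _)) ?expR_ge0//.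
rewrite ler_expR (le_trans (ler_norm _))// normrN !normrM.
rewrite (ger0_norm (pi_ge0 R)) (ger0_norm (ler0n R 2)).
by rewrite ler_wpM2r// ler_wpM2l// mulr_ge0// pi_ge0.
Qed.

(** For complex [z] the kernel [exp(2 i pi xi z)] may be unbounded on the line, but it is bounded on
    the band that carries the spectrum. *)
Lemma rint_mul_bounded_on (u k : R -> R) B M : measurable_fun setT k ->
  (forall t, `|t| <= B -> `|k t| <= M) -> (forall t, `|t| > B -> u t = 0) ->
  rint mu u -> rint mu (fun t => u t * k t).
Proof.
move=> mk kM su ui.
have mk' : measurable_fun setT (fun t => k t * \1_`[- B, B] t).
  by apply: measurable_funM => //; exact: measurable_indic.
have := @rint_bmulR R _ u `|M| mk' _ ui; move=> /(_ _)/eq_rint; apply.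
  move=> t; rewrite indicE mem_setE in_itv/= -ler_norml.
  by case: leP => [|/su->]; rewrite ?mulr1 ?mul0r.
move=> t; rewrite indicE mem_setE in_itv/= -ler_norml.
have [tB|_] := leP `|t| B; last by rewrite mulr0 normr0.
by rewrite mulr1 (le_trans (kM _ tB))// ler_norm.
Qed.

Lemma cexpE (xi : R) (z : C) :
  cexp (Complex 0 (2 * pi * xi) * z) = Complex (kre z xi) (kim z xi).
Proof.
case: z => x y; rewrite /cexp /expi /kre /kim /=.
have -> : 0 * x - 2 * pi * xi * y = - (2 * pi * xi * y) by ring.
have -> : 0 * y + 2 * pi * xi * x = 2 * pi * x * xi by ring.
by congr Complex; ring.
Qed.

(** The formula covers all complex [z], as the final equality of [f] and [g] up to sign on the whole
    plane requires. *)
Lemma PW_spectrum B (f : C -> C) : PW B f ->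
  exists F1 F2 : R -> R,
  [/\ [/\ rint mu F1, rint mu F2, rint mu (fun t => F1 t ^+ 2) &
          rint mu (fun t => F2 t ^+ 2)],
      (forall t, `|t| >= B -> F1 t = 0 /\ F2 t = 0) &
      forall z, f z = Complex (\int[mu]_t (F1 t * kre z t - F2 t * kim z t))
                              (\int[mu]_t (F2 t * kre z t + F1 t * kim z t))].
Proof.
move=> [F [FL2 fE]].
have mcc : measurable (`[- B, B] : set R) by exact: measurable_itv.
have moo : measurable (`]- B, B[ : set R) by exact: measurable_itv.
have oocc : (`]- B, B[ : set R) `<=` `[- B, B] by apply: subset_itv; rewrite bnd_simp.
have FL2' : cL2 `]- B, B[ F.
  move: FL2 => [[m1 m2] fin]; split; first by split; exact: measurable_funS m1 || exact: measurable_funS m2.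
  apply: le_lt_trans fin; apply: ge0_subset_integral => //.
    by apply/measurable_EFinP; apply: measurable_funX; exact: measurable_cabs.
  by move=> t _; rewrite lee_fin sqr_ge0.
(* The spectrum is cut off to the closed band, for integrability over the original domain, and to
   the open band, for the functions that are returned. *)
have [c1m c2m c1s c2s] := cL2_parts mcc FL2.
have [m1 m2 s1 s2] := cL2_parts moo FL2'.
set c1 := (_ \_ _) in c1m c1s; set c2 := (_ \_ _) in c2m c2s.
set F1 := (_ \_ _) in m1 s1; set F2 := (_ \_ _) in m2 s2.
have supp t : `|t| >= B -> F1 t = 0 /\ F2 t = 0.
  by move=> tB; rewrite /F1 /F2 !patchE mem_setE in_itv/= -ltr_norml ltNge tB.
have csupp t : `|t| > B -> c1 t = 0 /\ c2 t = 0.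
  by move=> tB; rewrite /c1 /c2 !patchE mem_setE in_itv/= -ler_norml leNgt tB.
have F1i : rint mu F1.
  by apply: (rint_bounded_support (A := B)) => // t /ltW /supp[].
have F2i : rint mu F2.
  by apply: (rint_bounded_support (A := B)) => // t /ltW /supp[].
have c1i : rint mu c1 by apply: (rint_bounded_support (A := B)) => // t /csupp[].
have c2i : rint mu c2 by apply: (rint_bounded_support (A := B)) => // t /csupp[].
exists F1, F2; split => // z; rewrite fE /cintegral.
pose M := expR (2 * pi * B * `|im z|).
have bre t : `|t| <= B -> `|kre z t| <= M by move=> tB; apply: damping_bound => //; exact: cos_norm.
have bim t : `|t| <= B -> `|kim z t| <= M by move=> tB; apply: damping_bound => //; exact: sin_norm.
have ci (u k : R -> R) : rint mu u -> (forall t, `|t| > B -> u t = 0) -> measurable_fun setT k ->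
    (forall t, `|t| <= B -> `|k t| <= M) -> rint mu (fun t => u t * k t).
  by move=> ui su mk kM; exact: (rint_mul_bounded_on mk kM su ui).
have s1' t : `|t| > B -> c1 t = 0 by move=> /csupp[].
have s2' t : `|t| > B -> c2 t = 0 by move=> /csupp[].
have mkr := measurable_kre z; have mki := measurable_kim z.
have ReE t : re (F t * cexp (Complex 0 (2 * pi * t) * z)) = re (F t) * kre z t - im (F t) * kim z t.
  by rewrite cexpE; case: (F t).
have ImE t : im (F t * cexp (Complex 0 (2 * pi * t) * z)) = im (F t) * kre z t + re (F t) * kim z t.
  by rewrite cexpE; case: (F t) => a b /=; rewrite addrC.
congr Complex.
- under eq_Rintegral do rewrite ReE.
  rewrite Rint_itvcc_itvoo.
    apply: eq_Rintegral => t _; rewrite /F1 /F2 !patchE.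
    by case: ifPn => _; rewrite ?mul0r ?subrr.
  rewrite integrable_mkcond//.
  have := rintB (ci _ _ c1i s1' mkr bre) (ci _ _ c2i s2' mki bim).
  apply: eq_integrable => // t _ /=; rewrite /c1 /c2 !patchE.
  by case: ifPn => _ //; rewrite !mul0r subrr.
- under eq_Rintegral do rewrite ImE.
  rewrite Rint_itvcc_itvoo.
    apply: eq_Rintegral => t _; rewrite /F1 /F2 !patchE.
    by case: ifPn => _; rewrite ?mul0r ?addr0.
  rewrite integrable_mkcond//.
  have := rintD (ci _ _ c2i s2' mkr bre) (ci _ _ c1i s1' mki bim).
  apply: eq_integrable => // t _ /=; rewrite /c1 /c2 !patchE.
  by case: ifPn => _ //; rewrite !mul0r addr0.
Qed.

Lemma kre_real (t xi : R) : kre (Complex t 0) xi = cos (2 * pi * t * xi).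
Proof. by rewrite /kre /= mulr0 oppr0 expR0 mul1r. Qed.

Lemma kim_real (t xi : R) : kim (Complex t 0) xi = sin (2 * pi * t * xi).
Proof. by rewrite /kim /= mulr0 oppr0 expR0 mul1r. Qed.

(** At frequency 0 the modulation is 1, and a real window with a real [f] leaves no imaginary
    part. *)
Lemma stftE (phi : R -> R) (f : C -> C) x : (forall t, im (f (Complex t 0)) = 0) ->
  stft (fun t => Complex (phi t) 0) (restrR f) x 0 =
  Complex (\int[mu]_t (re (f (Complex t 0)) * phi (t - x))) 0.
Proof.
move=> freal; rewrite /stft /cintegral /restrR /expi.
have E t : f (Complex t 0) * conjc (Complex (phi (t - x)) 0) *
    Complex (cos (- (2 * pi * t * 0))) (sin (- (2 * pi * t * 0))) =
    Complex (re (f (Complex t 0)) * phi (t - x)) 0.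
  rewrite mulr0 oppr0 cos0 sin0; have := freal t.
  case: (f _) => a b /= ->.
  by apply/eqP; rewrite eq_complex /=; apply/andP; split; apply/eqP; ring.
by congr Complex; under eq_Rintegral do rewrite E; rewrite //= Rint0.
Qed.

Lemma fourierL1_real (v : R -> R) xi :
  fourierL1 (fun t => Complex (v t) 0) xi = Complex (cosft v xi) (\int[mu]_t (- (v t * sin (2 * pi * xi * t)))).
Proof.
rewrite /fourierL1 /cintegral /expi /cosft; congr Complex; apply: eq_Rintegral => t _ /=.
  by rewrite mul0r subr0 cosN; congr (_ * cos _); ring.
by rewrite mul0r addr0 sinN mulrN; congr (- (_ * sin _)); ring.
Qed.

(** The truncated windows form one of the sequences over which [is_fourierL2] quantifies; the
    distance then unfolds into real and imaginary part. *)
Lemma fourierL2_truncated (phi : R -> R) (Phi : R -> C) :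
  cL2 setT (fun t => Complex (phi t) 0) ->
  is_fourierL2 (fun t => Complex (phi t) 0) Phi ->
  (\int[mu]_t ((cosft (trunc_itv phi n) t - re (Phi t)) ^+ 2 +
    (sinft (trunc_itv phi n) t + im (Phi t)) ^+ 2)%:E)%E @[n --> \oo] --> 0%E.
Proof.
move=> phiL2 [_ H].
have [mphi _ phisq _] := cL2_parts measurableT phiL2.
rewrite patch_setT /= in mphi; rewrite patch_setT /= in phisq.
pose v n t := Complex (trunc_itv phi n t) 0 : C.
have vi n := trunc_itv_int mphi phisq n.
have mv n : measurable_fun setT (trunc_itv phi n) by exact: rint_measurable (vi n).
have cmv n : cmeasurable setT (v n) by split; [exact: mv|exact: measurable_cst].
have trsq n t : trunc_itv phi n t ^+ 2 <= phi t ^+ 2.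
  by rewrite -[leLHS]real_normK ?num_real// -[leRHS]real_normK ?num_real// ler_sqr ?nnegrE// trunc_itv_norm.
have vL n : cL1 setT (v n) /\ cL2 setT (v n).
  split; split => //.
    have /integrableP[_] := vi n; congr (_ < _)%E; apply: eq_integral => t _.
    by rewrite /v cabs_real.
  have /integrableP[_] := phisq; apply: le_lt_trans; apply: ge0_le_integral => //.
  - by move=> t _; rewrite lee_fin sqr_ge0.
  - by apply/measurable_EFinP; apply: measurable_funX; exact: measurable_cabs.
  - apply/measurable_EFinP; apply: measurableT_comp => //; exact: measurable_funX.
  - by move=> t _; rewrite lee_fin /v cabs_real /= real_normK ?num_real// ger0_norm ?sqr_ge0.
(* The squared differences are bounded by [phi^2] and vanish at each point from some [n] on. *)
have vphi : cL2dist2 (v n) (fun t => Complex (phi t) 0) @[n --> \oo] --> 0%E.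
  have [|||dint] := @Rint_dominated _ _ R mu (fun n t => (trunc_itv phi n t - phi t) ^+ 2)
    (fun=> 0) (fun t => phi t ^+ 2) _ phisq.
  - by move=> n; apply: measurable_funX; exact: (measurable_funB (mv n) mphi).
  - move=> n t; rewrite ger0_norm ?sqr_ge0// /trunc_itv indicE.
    by case: (_ \in _); rewrite ?mulr1 ?subrr ?expr0n ?sqr_ge0// mulr0 sub0r sqrrN.
  - move=> t; apply: cvg_near_cst; have := near_trunc_itv phi t.
    by apply: filterS => n ->; rewrite subrr expr0n.
  rewrite Rint0 => lim0.
  have dE n : cL2dist2 (v n) (fun t => Complex (phi t) 0) =
      (\int[mu]_t (trunc_itv phi n t - phi t) ^+ 2)%:E.
    rewrite -rint_EFin.
      by apply: eq_integral => t _; rewrite cabs_sqr /= subrr expr0n addr0.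
    apply: (@rint_dom _ _ R mu (fun t => phi t ^+ 2)) => //.
      by apply: measurable_funX; exact: (measurable_funB (mv n) mphi).
    move=> t; rewrite ger0_norm ?sqr_ge0// /trunc_itv indicE.
    by case: (_ \in _); rewrite ?mulr1 ?subrr ?expr0n ?sqr_ge0// mulr0 sub0r sqrrN.
  by under eq_cvg do rewrite dE; apply: cvg_EFin => //; exact: nearW.
rewrite (_ : (fun n => _) = fun n => cL2dist2 (fourierL1 (v n)) Phi); first exact: H.
apply/funext => n; apply/esym.
apply: eq_integral => t _; congr EFin; rewrite cabs_sqr fourierL1_real.
have -> : (\int[mu]_s (- (trunc_itv phi n s * sin (2 * pi * t * s)))) = - sinft (trunc_itv phi n) t.
  rewrite -[RHS]mulN1r -RintegralZl//; last exact: rint_sinR.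
  by apply: eq_Rintegral => s _; rewrite mulN1r.
by case: (Phi t) => a b /=; congr (_ + _); rewrite -opprD sqrrN.
Qed.

End ComplexBridge.

Section StftSpectrum.
Variables (R : realType) (B : R) (phi : R -> R) (Phi : R -> R[i]).
Hypothesis B0 : 0 < B.
Hypothesis phiL2 : cL2 setT (fun t => Complex (phi t) 0).
Hypothesis phiF : is_fourierL2 (fun t => Complex (phi t) 0) Phi.
Local Notation mu := (@lebesgue_measure R).
Local Notation c := (fun t => complex.Re (Phi t)).
Local Notation e := (fun t => complex.Im (Phi t)).

Lemma stft_spectrum (F1 F2 : R -> R) (f : R[i] -> R[i]) :
  [/\ rint mu F1, rint mu F2, rint mu (fun t => F1 t ^+ 2) &
      rint mu (fun t => F2 t ^+ 2)] ->
  (forall t, `|t| >= B -> F1 t = 0 /\ F2 t = 0) ->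
  (forall z, f z = Complex (\int[mu]_t (F1 t * kre z t - F2 t * kim z t))
                           (\int[mu]_t (F2 t * kre z t + F1 t * kim z t))) ->
  (forall t : R, complex.Im (f (Complex t 0)) = 0) ->
  let P1 t := F1 t * c t + F2 t * e t in let P2 t := F2 t * c t - F1 t * e t in
  [/\ rint mu P1, rint mu P2,
      forall t, `|t| >= B -> P1 t = 0 /\ P2 t = 0,
      forall x, imft mu id P1 P2 x = 0 &
      forall x, rint mu (fun t => complex.Re (f (Complex t 0)) * phi (t - x)) /\
        stft (fun t => Complex (phi t) 0) (restrR f) x 0 =
        Complex (reft mu id P1 P2 (2 * pi * x)) 0].
Proof.
move=> [F1i F2i F1s F2s] Fsupp fE freal P1 P2.
have [] := cL2_parts measurableT phiL2; rewrite !patch_setT /= => mphi _ phis _.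
have [] := cL2_parts measurableT phiF.1; rewrite !patch_setT /= => mc me cs es.
have lim := fourierL2_truncated phiL2 phiF.
have mF1 := rint_measurable F1i; have mF2 := rint_measurable F2i.
have Fsupp' t : `|t| > B -> F1 t = 0 /\ F2 t = 0 by move=> /ltW /Fsupp.
have P1i : rint mu P1 by apply: rintD; exact: rint_mulL2.
have P2i : rint mu P2 by apply: rintB; exact: rint_mulL2.
have reE t : complex.Re (f (Complex t 0)) = reft mu id F1 F2 (2 * pi * t).
  by rewrite fE /=; apply: eq_Rintegral => s _; rewrite kre_real kim_real.
have imE t : imft mu id F1 F2 (2 * pi * t) = 0.
  rewrite -(freal t) fE /=; apply: eq_Rintegral => s _.
  by rewrite kre_real kim_real.
split => //.
- by move=> t /Fsupp[f1 f2]; rewrite /P1 /P2 f1 f2 !mul0r addr0 subr0.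
- move=> y.
  (* Parseval for [- i F = F2 - i F1]: the real part of its transform is the imaginary part of that
     of [F], zero for real [f], and the resulting identity is the vanishing of [imft]. *)
  have NF1i : rint mu (fun t => - F1 t) := rintN F1i.
  have NF1s : rint mu (fun t => (- F1 t) ^+ 2) by apply: eq_rint F1s => t; rewrite sqrrN.
  have Fsupp2 t : `|t| > B -> F2 t = 0 /\ - F1 t = 0 by move=> /Fsupp'[-> ->]; rewrite oppr0.
  have [_ +] := parseval B0 F2i NF1i F2s NF1s Fsupp2 mphi phis mc cs me es lim (y / (2 * pi)).
  have -> : 2 * pi * (y / (2 * pi)) = y by rewrite mulrC divfK// mulf_neq0// gt_eqF// pi_gt0.
  under eq_Rintegral => t _.
    rewrite (_ : reft mu id F2 (fun t => - F1 t) (2 * pi * t) = 0); last first.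
      by rewrite -(imE t); apply: eq_Rintegral => s _; rewrite /=; ring.
    rewrite mul0r; over.
  rewrite /= Rint0 => h; rewrite [RHS]h; apply: eq_Rintegral => s _; rewrite /P1 /P2 /=; ring.
- move=> x; have [i1 i2] := parseval B0 F1i F2i F1s F2s Fsupp' mphi phis mc cs me es lim x.
  split; first by apply: eq_rint i1 => t; rewrite reE.
  rewrite stftE// -i2; congr Complex; apply: eq_Rintegral => t _.
  by rewrite reE.
Qed.

End StftSpectrum.

(** * Comparison of the two spectra *)

Lemma transform_linear (R : realType) (u1 u2 w1 w2 : R -> R) s x :
  let mu := @lebesgue_measure R in
  rint mu u1 -> rint mu u2 -> rint mu w1 -> rint mu w2 ->
  reft mu id (fun t => u1 t + s * u2 t) (fun t => w1 t + s * w2 t) x =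
    reft mu id u1 w1 x + s * reft mu id u2 w2 x /\
  imft mu id (fun t => u1 t + s * u2 t) (fun t => w1 t + s * w2 t) x =
    imft mu id u1 w1 x + s * imft mu id u2 w2 x.
Proof.
move=> mu u1i u2i w1i w2i.
have rei u w : rint mu u -> rint mu w -> rint mu (fun t => u t * cos (x * t) - w t * sin (x * t)).
  by move=> ui wi; apply: rintB; [exact: rint_cosR|exact: rint_sinR].
have imi u w : rint mu u -> rint mu w -> rint mu (fun t => w t * cos (x * t) + u t * sin (x * t)).
  by move=> ui wi; apply: rintD; [exact: rint_cosR|exact: rint_sinR].
have re1 := rei _ _ u1i w1i; have re2 := rei _ _ u2i w2i.
have im1 := imi _ _ u1i w1i; have im2 := imi _ _ u2i w2i.
split; rewrite /reft /imft -RintegralZl// -RintegralD//.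
- by apply: eq_Rintegral => t _ /=; ring.
- exact: rintZ.
- by apply: eq_Rintegral => t _ /=; ring.
- exact: rintZ.
Qed.

(** The two equations say [(a + i b) conj z = 0], and the squared modulus is multiplicative. *)
Lemma conj_mul_eq0 (R : realType) (a b : R) (z : R[i]) : z != 0 ->
  a * complex.Re z + b * complex.Im z = 0 -> b * complex.Re z - a * complex.Im z = 0 ->
  a = 0 /\ b = 0.
Proof.
case: z => c e /= z0 h1 h2.
have : (a ^+ 2 + b ^+ 2) * (c ^+ 2 + e ^+ 2) = 0.
  transitivity ((a * c + b * e) ^+ 2 + (b * c - a * e) ^+ 2); first by ring.
  by rewrite h1 h2 expr0n addr0.
move/eqP; rewrite mulf_eq0 => /orP[|].
  by rewrite paddr_eq0 ?sqr_ge0// !sqrf_eq0 => /andP[/eqP-> /eqP->].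
rewrite paddr_eq0 ?sqr_ge0// !sqrf_eq0 => /andP[/eqP c0 /eqP e0].
by move: z0; rewrite c0 e0 eqxx.
Qed.

(** Negation exchanges the positive and the negative part; an infinite integral counts as 0 on both
    sides, so [u] may be arbitrary. *)
Lemma RintN (R : realType) (u : R -> R) :
  let mu := @lebesgue_measure R in (\int[mu]_t (- u t)) = - \int[mu]_t u t.
Proof.
move=> mu; rewrite /Rintegral; pose v (t : R) := (u t)%:E.
have -> : (\int[mu]_t (- u t)%:E = \int[mu]_t (\- v) t)%E by [].
have -> : (\int[mu]_t (u t)%:E = \int[mu]_t v t)%E by [].
rewrite [in LHS]integralE [in RHS]integralE funeposN funenegN.
have : (0 <= \int[mu]_t v^\+ t)%E by exact: integral_ge0.
have : (0 <= \int[mu]_t v^\- t)%E by exact: integral_ge0.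
case: (\int[mu]_t v^\+ t)%E => [a| |]//;
  case: (\int[mu]_t v^\- t)%E => [b| |]//= _ _; rewrite ?oppr0//.
by rewrite opprB.
Qed.

Theorem theorem2p3 (R : realType) (B : R) (phi : R -> R) :
  0 < B ->
  cL2 setT (fun t => Complex (phi t) 0) ->
  (exists Phi : R -> R[i],
      is_fourierL2 (fun t => Complex (phi t) 0) Phi /\
      {ae (@lebesgue_measure R), forall xi, `]- B, B[%classic xi -> Phi xi != 0}) ->
  forall f g : R[i] -> R[i],
    PW B f -> PW B g ->
    (forall t : R, complex.Im (f (Complex t 0)) = 0) ->
    (forall t : R, complex.Im (g (Complex t 0)) = 0) ->
    ((f = g \/ f = (fun z => - g z)) <->
     (forall n : int,
        cabs (stft (fun t => Complex (phi t) 0) (restrR f) (n%:~R / (4 * B)) 0)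
        = cabs (stft (fun t => Complex (phi t) 0) (restrR g) (n%:~R / (4 * B)) 0))).
Proof.
move=> B0 phiL2 [Phi [phiF Phi0]] f g PWf PWg freal greal.
set mu := @lebesgue_measure R.
have ae_filter : Filter (nbhs (almost_everywhere mu)) := ae_filter_ringOfSetsType mu.
have [F1 [F2 [HF Fsupp fE]]] := PW_spectrum PWf.
have [G1 [G2 [HG Gsupp gE]]] := PW_spectrum PWg.
have [F1i F2i _ _] := HF; have [G1i G2i _ _] := HG.
have [Pf1i Pf2i Pfs Pfim Pf] := stft_spectrum B0 phiL2 phiF HF Fsupp fE freal.
have [Pg1i Pg2i Pgs Pgim Pg] := stft_spectrum B0 phiL2 phiF HG Gsupp gE greal.
set Pf1 := (fun t => F1 t * _ + _) in Pf1i Pfs Pfim Pf.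
set Pf2 := (fun t => F2 t * _ - _) in Pf2i Pfs Pfim Pf.
set Pg1 := (fun t => G1 t * _ + _) in Pg1i Pgs Pgim Pg.
set Pg2 := (fun t => G2 t * _ - _) in Pg2i Pgs Pgim Pg.
(* In the easy direction a sign passes through the integral and disappears in the modulus. *)
split=> [[->//|fg] n|H].
  rewrite !stftE// !cabs_real -[RHS]normrN; congr (`|_|).
  rewrite -RintN; apply: eq_Rintegral => t _; rewrite fg.
  by case: (g _) => a b /=; rewrite mulNr.
(* The sample point [n / (4B)] has angular frequency [n pi / (2B)]. *)
have PfPg (n : int) : let x := n%:~R * (pi / (2 * B)) in
    `|reft mu id Pf1 Pf2 x| = `|reft mu id Pg1 Pg2 x|.
  move=> x; have := H n; rewrite (Pf _).2 (Pg _).2 !cabs_real.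
  by have -> : 2 * pi * (n%:~R / (4 * B)) = x by rewrite /x; field; rewrite gt_eqF.
(* [s = -1] gives the spectrum of the difference of the two transforms, [s = 1] that of their
   sum. *)
pose P1 s t := Pf1 t + s * Pg1 t; pose P2 s t := Pf2 t + s * Pg2 t.
have P1i s : rint mu (P1 s) by apply: rintD => //; exact: rintZ.
have P2i s : rint mu (P2 s) by apply: rintD => //; exact: rintZ.
have Psupp s t : `|t| >= B -> P1 s t = 0 /\ P2 s t = 0.
  move=> tB; have [f1 f2] : Pf1 t = 0 /\ Pf2 t = 0 := Pfs _ tB.
  have [g1 g2] : Pg1 t = 0 /\ Pg2 t = 0 := Pgs _ tB.
  by rewrite /P1 /P2 f1 f2 g1 g2 mulr0 addr0.
have Pim s x : imft mu id (P1 s) (P2 s) x = 0.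
  by rewrite (transform_linear s x Pf1i Pg1i Pf2i Pg2i).2 Pfim Pgim mulr0 addr0.
(* If the combined spectrum vanishes, cancelling [conj Phi] on the band gives [F = - s G] almost
   everywhere, hence [f = - s g]. *)
have scaled s : {ae mu, forall t, P1 s t = 0 /\ P2 s t = 0} -> forall z,
    f z = Complex (\int[mu]_t (- s * (G1 t * kre z t - G2 t * kim z t)))
                  (\int[mu]_t (- s * (G2 t * kre z t + G1 t * kim z t))).
  move=> P0 z.
  have FG : {ae mu, forall t, F1 t = - s * G1 t /\ F2 t = - s * G2 t}.
    move: P0 Phi0; apply: filterS2 => t [p1 p2] Phit.
    have [tB|tB] := leP B `|t|.
      by have [-> ->] := Fsupp _ tB; have [-> ->] := Gsupp _ tB; rewrite mulr0.
    have {}Phit : Phi t != 0 by apply: Phit; rewrite /= in_itv/= -ltr_norml.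
    have [||h1 h2] := @conj_mul_eq0 _ (F1 t + s * G1 t) (F2 t + s * G2 t) _ Phit.
    - by rewrite -[RHS]p1 /P1 /Pf1 /Pg1; ring.
    - by rewrite -[RHS]p2 /P2 /Pf2 /Pg2; ring.
    by split; apply/eqP; rewrite -subr_eq0 mulNr opprK ?h1 ?h2.
  have mm (u k : R -> R) : rint mu u -> measurable_fun setT k ->
      measurable_fun setT (fun t => u t * k t).
    by move=> ui mk; exact: (measurable_funM (rint_measurable ui) mk).
  have mr := measurable_kre z; have mi := measurable_kim z.
  have me : forall (a : R) (h : R -> R), measurable_fun setT h ->
      measurable_fun setT (fun t => a * h t) by move=> a h mh; exact: measurable_funM.
  rewrite fE; congr Complex; apply: Rint_ae_eq.
  - by apply: measurable_funB; exact: mm.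
  - by apply: me; apply: measurable_funB; exact: mm.
  - by move: FG; apply: filterS => t [-> ->]; ring.
  - by apply: measurable_funD; exact: mm.
  - by apply: me; apply: measurable_funD; exact: mm.
  - by move: FG; apply: filterS => t [-> ->]; ring.
have [|/scaled fg|/scaled fg] := @transform_mul_unique R B B0 (P1 (-1)) (P2 (-1)) (P1 1) (P2 1)
  (P1i _) (P2i _) (P1i _) (P2i _) (Psupp _) (Psupp _) (Pim _) (Pim _).
- move=> n x.
  (* The product is the difference of the squares of the two real transforms, which is 0 by equality
     of the moduli. *)
  rewrite (transform_linear (-1) x Pf1i Pg1i Pf2i Pg2i).1.
  rewrite (transform_linear 1 x Pf1i Pg1i Pf2i Pg2i).1 mulN1r mul1r -subr_sqr.
  apply/eqP; rewrite subr_eq0 -[eqbLHS]real_normK ?num_real// PfPg.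
  by rewrite real_normK ?num_real.
- left; apply/funext => z; rewrite fg gE; congr Complex;
    by apply: eq_Rintegral => t _; rewrite opprK mul1r.
- right; apply/funext => z; rewrite fg gE /=.
  have negE (a b : R) : - Complex a b = Complex (- a) (- b) by [].
  rewrite negE -!RintN.
  by congr Complex; apply: eq_Rintegral => t _; rewrite mulN1r.
Qed.
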